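(* The set of patterns $\{2143, 3142, 246135\}$ is Wilf-equivalent to the set of patterns $\{2413, 3142\}$; that is, for every $n$, the number of permutations of length $n$ avoiding $2143$, $3142$ and $246135$ equals the number of permutations of length $n$ avoiding $2413$ and $3142$.
   Context: A permutation $\pi$ avoids a pattern $\sigma$ if $\pi$ has no subsequence order-isomorphic to $\sigma$. *)

(* Defs.v *)
From mathcomp Require Import all_boot all_fingroup.

Set Implicit Arguments.
Unset Strict Implicit.
Unset Printing Implicit Defensive.

(* Words are finite sequences of naturals; a pattern is given by its one-line
   notation, e.g. 2413 is [:: 2; 4; 1; 3]. *)
Definition order_iso (s t : seq nat) : bool :=
  (size s == size t) &&
  [forall i : 'I_(size s), forall j : 'I_(size s),
     (nth 0 s i < nth 0 s j) == (nth 0 t i < nth 0 t j)].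

(* Values run over 0, ..., n-1 rather than 1, ..., n; [order_iso] is
   insensitive to this shift. *)
Definition one_line n (p : 'S_n) : seq nat := [seq val (p i) | i <- enum 'I_n].

(* The masks [m] index the subsequences of the word of [p]; see [containsP]. *)
Definition contains n (p : 'S_n) (sigma : seq nat) : bool :=
  [exists m : n.-tuple bool, order_iso (mask m (one_line p)) sigma].

Definition avoids n (p : 'S_n) (sigma : seq nat) : bool := ~~ contains p sigma.

Definition Av n (B : seq (seq nat)) : {set 'S_n} :=
  [set p : 'S_n | all (avoids p) B].

Definition wilf_equivalent (B C : seq (seq nat)) : Prop :=
  forall n : nat, #|Av n B| = #|Av n C|.

Lemma size_one_line n (p : 'S_n) : size (one_line p) = n.
Proof. by rewrite size_map size_enum_ord. Qed.

Lemma containsP n (p : 'S_n) (sigma : seq nat) :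
  reflect (exists2 s, subseq s (one_line p) & order_iso s sigma)
          (contains p sigma).
Proof.
apply: (iffP existsP) => [[m iso_m] | [s /subseqP[m sz_m ->] iso_m]].
  by exists (mask m (one_line p)); first exact: mask_subseq.
rewrite size_one_line in sz_m.
by exists (tcast sz_m (in_tuple m)); rewrite val_tcast.
Qed.

(* Main.v *)
Require Import Defs.
From mathcomp Require Import all_boot all_fingroup zify.

Set Implicit Arguments.
Unset Strict Implicit.
Unset Printing Implicit Defensive.

(** In either class let [a n] count all permutations of length [n] and [h n] the
skew-indecomposable ones.  Splitting off the lowest skew component gives
[a n = \sum_(1 <= k <= n) h k * a (n - k)], so it suffices to show
[a n = 2 * h n] for [n >= 2] in both classes.

A separable permutation of length at least 2 is either skew- or
sum-decomposable, not both, and complementation exchanges the two.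

For Av(2143, 3142, 246135) let [N i j n] count the permutations [w = X V C] with
[size X = i] and [size C = j] such that [X ++ C] is increasing and no occurrence
of 2413 in [w] has its 4 in [X] or its 1 in [C].  Reverse-complement gives
[N i j = N j i].  Let [i > 0].  If [w] starts with its minimum, remove it.
Otherwise the lowest skew component of the letters below the first letter is a
factor of [w], what follows it is a legitimate suffix [C'] extending [C], and it
can be removed and reinserted freely.  Hence, writing [*] for convolution,
[N i j n = N (i-1) j (n-1) + \sum_(j' >= j) (h * N i j') n].
By induction on [n], [N] depends only on [i + j] and [N i (j+1) = h * N i j];
comparing [N 1 0] with [N 1 1] yields [a n = 2 * (h * N 1 0) n = 2 * h n]. *)

(** * Pattern avoidance for words *)

Lemma subseq_cat_split (T : eqType) (t s1 s2 : seq T) :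
  subseq t (s1 ++ s2) ->
  exists q, [/\ q <= size t, subseq (take q t) s1 & subseq (drop q t) s2].
Proof.
case/subseqP=> m; rewrite size_cat => sz_m ->.
have sz1: size (take (size s1) m) = size s1.
  by rewrite size_take_min sz_m; lia.
rewrite -{1 2 3}(cat_take_drop (size s1) m) mask_cat //.
exists (size (mask (take (size s1) m) s1)).
by rewrite size_cat leq_addr take_size_cat // drop_size_cat // !mask_subseq.
Qed.

Lemma subseq_cat3_split (T : eqType) (t s1 s2 s3 : seq T) :
  subseq t (s1 ++ s2 ++ s3) ->
  exists q r, [/\ q + r <= size t, subseq (take q t) s1,
    subseq (take r (drop q t)) s2 & subseq (drop r (drop q t)) s3].
Proof.
case/subseq_cat_split=> q [le_q sub1 /subseq_cat_split[r [le_r sub2 sub3]]].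
by exists q, r; split=> //; move: le_r; rewrite size_drop; lia.
Qed.

Lemma all_subseq (T : eqType) (a : pred T) (t s : seq T) :
  all a s -> subseq t s -> all a t.
Proof. by move=> /allP a_s /mem_subseq sub; apply/allP=> x /sub/a_s. Qed.

(** An explicit list of subsequences keeps avoidance, and later [niceW], boolean, so that words can
    be counted. *)
Fixpoint subs (w : seq nat) : seq (seq nat) :=
  if w is x :: w' then map (cons x) (subs w') ++ subs w' else [:: [::]].

Lemma mem_subs t w : (t \in subs w) = subseq t w.
Proof.
elim: w t => [|x w IHw] [|y t] //=; rewrite mem_cat IHw.
  by rewrite sub0seq orbT.
case: eqP => [->|neq_yx].
  rewrite mem_map => [|? ? []//]; rewrite IHw.
  apply/orb_idr=> /(subseq_trans _) -> //; exact: subseq_cons.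
rewrite (_ : _ \in map _ _ = false) //.
by apply/mapP=> -[s _ [/neq_yx]].
Qed.

Lemma subs_map (f : nat -> nat) w : subs (map f w) = map (map f) (subs w).
Proof. by elim: w => //= x w ->; rewrite map_cat -!map_comp. Qed.

Definition wavoids (s w : seq nat) := all (fun t => ~~ order_iso t s) (subs w).

Lemma wavoidsP s w :
  reflect (forall t, subseq t w -> ~~ order_iso t s) (wavoids s w).
Proof.
by apply: (iffP allP) => H t; [rewrite -mem_subs | rewrite mem_subs]; apply: H.
Qed.

Lemma wavoids_subseq s u w : subseq u w -> wavoids s w -> wavoids s u.
Proof.
by move=> sub /wavoidsP H; apply/wavoidsP=> t /subseq_trans/(_ sub)/H.
Qed.

Lemma order_iso_mono (f : nat -> nat) t s :
  {mono f : x y / x < y} -> order_iso (map f t) s = order_iso t s.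
Proof.
move=> f_mono; rewrite /order_iso size_map; case: (size t =P size s) => //= sz.
by apply: eq_forallb => i; apply: eq_forallb => j; rewrite !(nth_map 0) ?f_mono.
Qed.

Lemma wavoids_mono (f : nat -> nat) s w :
  {mono f : x y / x < y} -> wavoids s (map f w) = wavoids s w.
Proof.
by move=> fm; rewrite /wavoids subs_map all_map; apply: eq_all => t /=; rewrite order_iso_mono.
Qed.

Lemma avoidsE n (p : 'S_n) s : avoids p s = wavoids s (one_line p).
Proof.
apply/idP/wavoidsP => [/containsP av t sub | av].
  by apply/negP=> iso; apply: av; exists t.
by apply/containsP=> -[t /av/negP].
Qed.

Lemma order_isoP s t : reflect
  (size s = size t /\ forall i j, i < size s -> j < size s ->
     (nth 0 s i < nth 0 s j) = (nth 0 t i < nth 0 t j)) (order_iso s t).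
Proof.
apply: (iffP andP) => [[/eqP sz /forallP H]|[sz H]]; split=> //.
- by move=> i j lt_i lt_j; have /forallP/(_ (Ordinal lt_j))/eqP := H (Ordinal lt_i).
- exact/eqP.
- by apply/forallP=> i; apply/forallP=> j; rewrite H.
Qed.

(** In this and the next three relations the letters are chained from smallest to largest, which
    fixes every pairwise comparison. *)
Definition p2143 a b c d := [&& b < a, a < d & d < c].
Definition p3142 a b c d := [&& b < d, d < a & a < c].
Definition p2413 a b c d := [&& c < a, a < d & d < b].
Definition p246135 a b c d e f := [&& d < a, a < e, e < b, b < f & f < c].

Lemma iso2143 a b c d : order_iso [:: a; b; c; d] [:: 2; 1; 4; 3] = p2143 a b c d.
Proof.
apply/order_isoP/idP => [[_ H] | H].
  by rewrite /p2143 (H 1 0) // (H 0 3) // (H 3 2).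
by split=> // [[|[|[|[|?]]]] [|[|[|[|?]]]]] //= _ _; move: H; rewrite /p2143; lia.
Qed.

Lemma iso3142 a b c d : order_iso [:: a; b; c; d] [:: 3; 1; 4; 2] = p3142 a b c d.
Proof.
apply/order_isoP/idP => [[_ H] | H].
  by rewrite /p3142 (H 1 3) // (H 3 0) // (H 0 2).
by split=> // [[|[|[|[|?]]]] [|[|[|[|?]]]]] //= _ _; move: H; rewrite /p3142; lia.
Qed.

Lemma iso2413 a b c d : order_iso [:: a; b; c; d] [:: 2; 4; 1; 3] = p2413 a b c d.
Proof.
apply/order_isoP/idP => [[_ H] | H].
  by rewrite /p2413 (H 2 0) // (H 0 3) // (H 3 1).
by split=> // [[|[|[|[|?]]]] [|[|[|[|?]]]]] //= _ _; move: H; rewrite /p2413; lia.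
Qed.

Lemma iso246135 a b c d e f :
  order_iso [:: a; b; c; d; e; f] [:: 2; 4; 6; 1; 3; 5] = p246135 a b c d e f.
Proof.
apply/order_isoP/idP => [[_ H] | H].
  by rewrite /p246135 (H 3 0) // (H 0 4) // (H 4 1) // (H 1 5) // (H 5 2).
by split=> // [[|[|[|[|[|[|?]]]]]] [|[|[|[|[|[|?]]]]]]] //= _ _;
  move: H; rewrite /p246135; lia.
Qed.

Lemma av4P s (r : nat -> nat -> nat -> nat -> bool) w : size s = 4 ->
  (forall a b c d, order_iso [:: a; b; c; d] s = r a b c d) ->
  reflect (forall a b c d, subseq [:: a; b; c; d] w -> ~~ r a b c d) (wavoids s w).
Proof.
move=> sz_s iso; apply: (iffP (wavoidsP _ _)) => [H a b c d /H|H t].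
  by rewrite iso.
move=> sub; apply/negP => iso_t; have [sz _] := order_isoP _ _ iso_t.
move: sz sub iso_t; rewrite sz_s; case: t => [|a [|b [|c [|d []]]]] //= _.
by rewrite iso => /H/negP.
Qed.

Lemma av2143P w : reflect (forall a b c d, subseq [:: a; b; c; d] w -> ~~ p2143 a b c d)
  (wavoids [:: 2; 1; 4; 3] w).
Proof. by apply: av4P => //; apply: iso2143. Qed.

Lemma av3142P w : reflect (forall a b c d, subseq [:: a; b; c; d] w -> ~~ p3142 a b c d)
  (wavoids [:: 3; 1; 4; 2] w).
Proof. by apply: av4P => //; apply: iso3142. Qed.

Lemma av2413P w : reflect (forall a b c d, subseq [:: a; b; c; d] w -> ~~ p2413 a b c d)
  (wavoids [:: 2; 4; 1; 3] w).
Proof. by apply: av4P => //; apply: iso2413. Qed.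

Lemma av246135P w : reflect
  (forall a b c d e f, subseq [:: a; b; c; d; e; f] w -> ~~ p246135 a b c d e f)
  (wavoids [:: 2; 4; 6; 1; 3; 5] w).
Proof.
apply: (iffP (wavoidsP _ _)) => [H a b c d e f /H|H t]; first by rewrite iso246135.
move=> sub; apply/negP => iso_t; have [sz _] := order_isoP _ _ iso_t.
move: sz sub iso_t; case: t => [|a [|b [|c [|d [|e [|f []]]]]]] //= _.
by rewrite iso246135 => /H/negP.
Qed.

Definition avoids_all (B : seq (seq nat)) (w : seq nat) := all (wavoids^~ w) B.

Lemma avoids_all_subseq B u w : subseq u w -> avoids_all B w -> avoids_all B u.
Proof. by move=> sub /allP H; apply/allP=> s /H; apply: wavoids_subseq. Qed.

Lemma avoids_all_mono B (f : nat -> nat) w :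
  {mono f : x y / x < y} -> avoids_all B (map f w) = avoids_all B w.
Proof. by move=> fm; apply: eq_all => s; apply: wavoids_mono. Qed.

Lemma addn_mono k : {mono addn k : x y / x < y}.
Proof. by move=> x y; rewrite ltn_add2l. Qed.

Lemma avoids_all_shift B k w : avoids_all B (map (addn k) w) = avoids_all B w.
Proof. exact/avoids_all_mono/addn_mono. Qed.

Definition inA := avoids_all [:: [:: 2; 1; 4; 3]; [:: 3; 1; 4; 2]; [:: 2; 4; 6; 1; 3; 5]].
Definition inS := avoids_all [:: [:: 2; 4; 1; 3]; [:: 3; 1; 4; 2]].

(** * Permutations as words on an initial segment of the naturals *)

Definition perms n := permutations (iota 0 n).

(** [one_line] is injective into [perms n], and both sides have [n] factorial elements, so it
    enumerates [perms n]. *)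
Lemma card_Av n B : #|Av n B| = count (avoids_all B) (perms n).
Proof.
have inj: injective (@one_line n).
  by move=> p q /eq_in_map eq_pq; apply/permP=> i; apply: val_inj; rewrite eq_pq ?mem_enum.
have mem_one (p : 'S_n) : one_line p \in perms n.
  rewrite mem_permutations; apply: uniq_perm; rewrite ?iota_uniq //.
    by rewrite map_inj_uniq ?enum_uniq // => i j /val_inj/perm_inj.
  move=> y; rewrite mem_iota add0n /=; apply/mapP/idP => [[i _ ->]|lt_y]; first exact: ltn_ord.
  by exists ((p^-1)%g (Ordinal lt_y)); rewrite ?mem_enum // permKV.
have all_perms: perm_eq (map (@one_line n) (enum {: 'S_n})) (perms n).
  have uniq_l: uniq (map (@one_line n) (enum {: 'S_n})).
    by rewrite map_inj_uniq ?enum_uniq.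
  have [||_ eq_mem] := uniq_min_size uniq_l (_ : {subset _ <= perms n}).
  - by move=> w /mapP[p _ ->].
  - by rewrite size_permutations ?iota_uniq // size_iota size_map -cardE card_Sn.
  by apply: uniq_perm; rewrite ?permutations_uniq.
rewrite -(seq.permP all_perms) count_map -sum1_card -sum1_count big_enum_cond /=.
apply: eq_bigl => p; rewrite inE /=.
apply: eq_all => s; exact: avoidsE.
Qed.

(** * Skew decomposition *)

Implicit Types d p q u v w : seq nat.

Lemma perms_size n w : w \in perms n -> size w = n.
Proof. by rewrite mem_permutations => /perm_size ->; rewrite size_iota. Qed.

Lemma perms_uniq n w : w \in perms n -> uniq w.
Proof. by rewrite mem_permutations => /perm_uniq ->; rewrite iota_uniq. Qed.

Lemma perms_mem n w : w \in perms n -> w =i gtn n.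
Proof. by rewrite mem_permutations => /perm_mem eqm y; rewrite eqm mem_iota. Qed.

Lemma perms_intro n w : uniq w -> w =i gtn n -> w \in perms n.
Proof.
by move=> un eqm; rewrite mem_permutations uniq_perm ?iota_uniq // => y; rewrite eqm mem_iota.
Qed.

Definition lows k (w : seq nat) := [seq x <- w | x < k].
Definition highs k (w : seq nat) := [seq x <- w | k <= x].

Lemma lows_perms n k w : w \in perms n -> k <= n -> lows k w \in perms k.
Proof.
move=> w_n le_kn; apply: perms_intro; first by rewrite filter_uniq ?(perms_uniq w_n).
by move=> y; rewrite mem_filter (perms_mem w_n) !inE; lia.
Qed.

Lemma highs_perms n k w :
  w \in perms n -> map (subn^~ k) (highs k w) \in perms (n - k).
Proof.
move=> w_n; apply: perms_intro.
  rewrite map_inj_in_uniq ?filter_uniq ?(perms_uniq w_n) //.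
  by move=> x y; rewrite !mem_filter; lia.
move=> y; apply/mapP/idP=> [[x]|lt_y].
  by rewrite mem_filter (perms_mem w_n) !inE => ? ->; lia.
move: lt_y; rewrite inE => lt_y; exists (y + k); rewrite ?addnK //.
by rewrite mem_filter (perms_mem w_n) !inE; lia.
Qed.

Lemma highs_shiftK k w : map (addn k) (map (subn^~ k) (highs k w)) = highs k w.
Proof.
rewrite -map_comp; apply: map_id_in => x /=; rewrite mem_filter; lia.
Qed.

Lemma lows_lows k k' w : k <= k' -> lows k (lows k' w) = lows k w.
Proof.
by move=> le_kk'; rewrite /lows -filter_predI; apply: eq_filter => x /=; lia.
Qed.

(* [block k j w]: the letters smaller than [k] occupy consecutive positions and
   are followed by exactly [j] letters. *)
Definition block k j (w : seq nat) :=
  (j + k <= size w) && (lows k w == take k (drop (size w - j - k) w)).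

(** A block followed by no letter is a skew cut; only proper nonempty cuts are excluded. *)
Definition indec (w : seq nat) := all (fun k => ~~ block k 0 w) (iota 1 (size w).-1).

Lemma indecP w :
  reflect (forall k, 0 < k < size w -> ~~ block k 0 w) (indec w).
Proof.
by apply: (iffP allP) => H k lt_k; apply: H; move: lt_k; rewrite mem_iota; lia.
Qed.

Lemma block_cat k j w : block k j w ->
  w = take (size w - j - k) w ++ lows k w ++ drop (size w - j) w.
Proof.
case/andP=> le_jk /eqP ->.
have ->: drop (size w - j) w = drop k (drop (size w - j - k) w).
  by rewrite drop_drop; congr drop; lia.
by rewrite !cat_take_drop.
Qed.

Lemma block_catl k (p d q : seq nat) :
  all (leq k) p -> all (gtn k) d -> all (leq k) q -> size d = k ->
  block k (size q) (p ++ d ++ q).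
Proof.
move=> hp hd hq sz_d; rewrite /block !size_cat; apply/andP; split; first by lia.
have low0 s : all (leq k) s -> lows k s = [::].
  rewrite /lows => /allP hs; rewrite -(filter_pred0 s).
  by apply: eq_in_filter => x /hs /=; lia.
rewrite /lows !filter_cat -/(lows k p) -/(lows k q) !low0 // cats0 /=.
rewrite (all_filterP _) // (_ : _ - _ - _ = size p); last by lia.
by rewrite drop_size_cat // take_size_cat.
Qed.

(** The factor in the middle already contains all letters below [k], and letters do not repeat. *)
Lemma block_highs n k j w : w \in perms n -> block k j w ->
  all (leq k) (take (size w - j - k) w) && all (leq k) (drop (size w - j) w).
Proof.
move=> w_n bl; have := bl => /andP[le_jk _].
have un := perms_uniq w_n; rewrite [w](block_cat bl) in un.
move: un; rewrite !cat_uniq !has_cat !negb_or.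
case/and3P=> _ /andP[d1 _] /and3P[_ d2 _].
have low_mem y : y \in w -> y < k -> y \in lows k w by rewrite mem_filter => -> ->.
apply/andP; split; apply/allP=> y y_in; rewrite leqNgt; apply/negP=> lt_yk.
  by case/hasP: d1; exists y => //; apply: low_mem => //; apply: mem_take y_in.
by case/hasP: d2; exists y => //; apply: low_mem => //; apply: mem_drop y_in.
Qed.

Lemma block_highsE n k j w : w \in perms n -> block k j w ->
  highs k w = take (size w - j - k) w ++ drop (size w - j) w.
Proof.
move=> w_n bl; have /andP[h1 h2] := block_highs w_n bl.
rewrite {1}[w](block_cat bl) /highs !filter_cat (all_filterP h1) (all_filterP h2).
congr (_ ++ _); rewrite -[RHS]cat0s; congr (_ ++ _).
by rewrite /lows -filter_predI -(filter_pred0 w); apply: eq_filter => x /=; lia.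
Qed.

Definition insert_block k j (d u : seq nat) :=
  take (size u - j) (map (addn k) u) ++ d ++ drop (size u - j) (map (addn k) u).

Lemma all_shift k s : all (leq k) (map (addn k) s).
Proof. by apply/allP=> _ /mapP[x _ ->]; rewrite leq_addr. Qed.

(** Together with [block_insertK], this makes insertion a bijection from pairs of permutations to
    permutations with a block at a prescribed place. *)
Lemma insert_blockP m k j d u :
  d \in perms k -> u \in perms m -> j <= m ->
  [/\ insert_block k j d u \in perms (k + m), block k j (insert_block k j d u),
   lows k (insert_block k j d u) = d
   & map (subn^~ k) (highs k (insert_block k j d u)) = u].
Proof.
move=> d_k u_m le_jm; have sz_u := perms_size u_m; have sz_d := perms_size d_k.
set w := insert_block k j d u.
have hi s : subseq s (map (addn k) u) -> all (leq k) s by apply/all_subseq/all_shift.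
have lo : all (gtn k) d by apply/allP=> y; rewrite (perms_mem d_k).
have w_perms : w \in perms (k + m).
  rewrite mem_permutations /w /insert_block perm_catCA cat_take_drop.
  rewrite iotaD perm_cat //; first by rewrite -mem_permutations.
  rewrite addnC iotaDl perm_map //.
  by rewrite -mem_permutations.
have bl : block k j w.
  rewrite -[X in block _ X](_ : size (drop (size u - j) (map (addn k) u)) = j).
    by apply: block_catl => //; apply: hi; [apply: take_subseq | apply: drop_subseq].
  by rewrite size_drop size_map; lia.
have sz_w : size w = k + m := perms_size w_perms.
have sz_t : size (take (size u - j) (map (addn k) u)) = m - j.
  by rewrite size_take_min size_map; lia.
split=> //.
  have /andP[_ /eqP ->] := bl; rewrite sz_w (_ : _ - _ - _ = m - j); last by lia.
  by rewrite /w /insert_block drop_size_cat // take_size_cat.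
rewrite (block_highsE w_perms bl) sz_w.
rewrite (_ : k + m - j - k = m - j); last by lia.
rewrite /w /insert_block catA drop_size_cat; last by rewrite size_cat; lia.
rewrite -catA take_size_cat // cat_take_drop -map_comp map_id_in // => x _ /=.
by rewrite addKn.
Qed.

Lemma block_insertK n k j w : w \in perms n -> block k j w ->
  insert_block k j (lows k w) (map (subn^~ k) (highs k w)) = w.
Proof.
move=> w_n bl; rewrite /insert_block highs_shiftK size_map (block_highsE w_n bl).
have /andP[le _] := bl.
have sz : size (take (size w - j - k) w) = size w - j - k by rewrite size_takel; lia.
rewrite size_cat sz size_drop (_ : _ + _ - j = size w - j - k); last by lia.
by rewrite take_size_cat // drop_size_cat // -(block_cat bl).
Qed.

(** * Counting by bijections and by disjoint cases *)

Lemma count_bij (T1 T2 : eqType) (P1 : pred T1) (P2 : pred T2) s1 s2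
    (f : T1 -> T2) (g : T2 -> T1) :
  uniq s1 -> uniq s2 ->
  (forall x, x \in s1 -> P1 x -> [/\ f x \in s2, P2 (f x) & g (f x) = x]) ->
  (forall y, y \in s2 -> P2 y -> [/\ g y \in s1, P1 (g y) & f (g y) = y]) ->
  count P1 s1 = count P2 s2.
Proof.
move=> un1 un2 fP gP; rewrite -!size_filter -(size_map f).
apply/perm_size/uniq_perm; rewrite ?filter_uniq //.
  rewrite map_inj_in_uniq ?filter_uniq // => x y; rewrite !mem_filter.
  case/andP=> Px xs /andP[Py ys] eqf; have [_ _ <-] := fP x xs Px.
  by have [_ _ <-] := fP y ys Py; rewrite eqf.
move=> y; apply/mapP/idP => [[x]|]; rewrite mem_filter => /andP[Px xs].
  by have [? ? _] := fP x xs Px => ->; rewrite mem_filter; apply/andP.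
by have [gs Pg gK] := gP y xs Px; exists (g y); rewrite ?mem_filter ?gs ?Pg.
Qed.

Lemma count_insert (P Q R : pred (seq nat)) n k j : k <= n ->
  (forall d u, d \in perms k -> u \in perms (n - k) -> Q d -> R u ->
     j <= n - k /\ P (insert_block k j d u)) ->
  (forall w, w \in perms n -> P w -> block k j w ->
     Q (lows k w) /\ R (map (subn^~ k) (highs k w))) ->
  count (fun w => P w && block k j w) (perms n) =
  count Q (perms k) * count R (perms (n - k)).
Proof.
move=> le_kn insP remP.
rewrite -(size_filter Q) -(size_filter R) -(size_allpairs pair).
rewrite -(count_predT (allpairs _ _ _)).
apply: (@count_bij _ _ _ _ _ _ (fun w => (lows k w, map (subn^~ k) (highs k w)))
  (fun p : seq nat * seq nat => insert_block k j p.1 p.2)).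
- exact: permutations_uniq.
- by apply: allpairs_uniq; rewrite ?filter_uniq ?permutations_uniq // => -[? ?] [? ?].
- move=> w w_n /andP[Pw bl]; have [Qw Rw] := remP _ w_n Pw bl; split=> //.
    by apply/allpairsP; exists (lows k w, map (subn^~ k) (highs k w));
       rewrite !mem_filter Qw Rw (lows_perms w_n) // highs_perms.
  exact: block_insertK w_n bl.
move=> _ /allpairsP[[d u] /= [+ + ->]] _; rewrite !mem_filter => /andP[Qd d_k] /andP[Ru u_k].
have [le_j Pdu] := insP _ _ d_k u_k Qd Ru.
have [] := insert_blockP d_k u_k le_j; rewrite subnKC //= => -> bl low high.
by split; rewrite ?Pdu ?bl // low high.
Qed.

Lemma count_sum (T : eqType) (s : seq T) (P : pred T) (B : nat -> pred T) n :
  (forall x : T, x \in s -> P x -> exists2 k, k < n & B k x) ->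
  (forall (x : T) k, x \in s -> k < n -> B k x -> P x) ->
  (forall (x : T) k k', x \in s -> k < k' < n -> B k x -> ~~ B k' x) ->
  count P s = \sum_(k < n) count (B k) s.
Proof.
move=> exB subB disj; elim: s exB subB disj => [|w s IHs] exB subB disj /=.
  by rewrite big1.
rewrite big_split /= -IHs.
- congr (_ + _); case: (boolP (P w)) => [/(exB w (mem_head _ _))[k lt_k Bk]|nP].
    rewrite (bigD1 (Ordinal lt_k)) //= Bk big1 // => i.
    rewrite -val_eqE /= neq_ltn => ne; apply/eqP; rewrite eqb0.
    case/orP: ne => lt; last by apply: disj Bk; rewrite ?mem_head ?lt ?ltn_ord.
    apply/negP=> Bi; have := @disj w i k (mem_head _ _).
    by rewrite lt lt_k Bk Bi => /(_ isT isT).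
  rewrite big1 // => i _; apply/eqP; rewrite eqb0; apply: contra nP.
  by apply: subB; rewrite ?mem_head.
- by move=> v vs; apply: exB; rewrite inE vs orbT.
- by move=> v k vs; apply: subB; rewrite inE vs orbT.
- by move=> v k k' vs; apply: disj; rewrite inE vs orbT.
Qed.

Lemma take_drop_take (T : Type) (s : seq T) k k' i i' : k <= k' -> k' + i' = k + i ->
  take k (drop (k' - k) (take k' (drop i' s))) = take k (drop i s).
Proof.
move=> le_kk' eq_i; rewrite -{2}(subnK le_kk') [k' - k + k]addnC -take_drop drop_drop.
rewrite take_takel //; congr (take _ (drop _ _)); lia.
Qed.

(* Two blocks ending at the same place are nested, so the larger is decomposable. *)
Lemma block_indec_disj w k k' j : 0 < k < k' -> block k j w -> block k' j w ->
  ~~ indec (lows k' w).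
Proof.
case/andP=> k_gt0 lt_kk' /andP[le_j /eqP blk] /andP[le_j' /eqP blk'].
have sz : size (lows k' w) = k' by rewrite blk' size_takel // size_drop; lia.
apply/negP=> /indecP/(_ k); rewrite sz k_gt0 lt_kk' => /(_ isT)/negP; apply.
have le_kk' := ltnW lt_kk'; rewrite /block sz add0n le_kk' lows_lows // blk blk' subn0.
by apply/eqP; rewrite (@take_drop_take _ w k k' (size w - j - k)) //; lia.
Qed.

(** A final factor of a final factor is final. *)
Lemma block_lows k k' w : k <= k' -> block k' 0 w -> block k 0 (lows k' w) -> block k 0 w.
Proof.
move=> le_kk' /andP[le' /eqP bl'] /andP[le /eqP].
have sz : size (lows k' w) = k' by rewrite bl' size_takel // size_drop; lia.
rewrite lows_lows // sz => eq_low; rewrite /block add0n eq_low.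
apply/andP; split; first by lia.
by rewrite bl' !subn0 (@take_drop_take _ w k k' (size w - k)) //; lia.
Qed.

(** The least positive skew cut works: by [block_lows] a cut of its component would be a smaller cut
    of [w]. *)
Lemma exists_lowest_block n w : w \in perms n -> 0 < n ->
  exists k, [/\ 0 < k <= n, block k 0 w, indec (lows k w)
             & forall k', 0 < k' < k -> ~~ block k' 0 w].
Proof.
move=> w_n n_gt0; have sz := perms_size w_n.
have: exists k, (0 < k) && block k 0 w.
  (* The whole word is a cut, so the minimum exists. *)
  exists n; rewrite n_gt0 /block sz leqnn subn0 subnn drop0 -{2}sz take_size /lows.
  by apply/eqP/all_filterP/allP=> y; rewrite (perms_mem w_n).
case/ex_minnP=> k /andP[k_gt0 bl] min_k.
have min k' : 0 < k' < k -> ~~ block k' 0 w.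
  case/andP=> k'_gt0; rewrite ltnNge; apply: contra => bl'.
  by apply: min_k; rewrite k'_gt0.
exists k; split=> //; first by case/andP: bl; rewrite k_gt0 sz; lia.
have le_kn : k <= n by case/andP: bl; rewrite sz.
apply/indecP=> k'; rewrite (perms_size (lows_perms w_n le_kn)) => lt_k'.
by apply: contra (min k' lt_k'); apply: block_lows bl; lia.
Qed.

Section SkewDecomposition.

Variable C : pred (seq nat).
Hypothesis C_sub : forall u w, subseq u w -> C w -> C u.
Hypothesis C_shift : forall k w, C (map (addn k) w) = C w.
Hypothesis C_skew : forall k u v,
  all (leq k) u -> all (gtn k) v -> C u -> C v -> C (u ++ v).

Definition num n := count C (perms n).
Definition num_indec n := count (fun w => C w && indec w) (perms n).

(** Words are sorted by the size [k.+1] of their lowest skew component, which exists by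
    [exists_lowest_block] and is unique by [block_indec_disj]. *)
Lemma num_skew n : 0 < n ->
  num n = \sum_(k < n) num_indec k.+1 * num (n - k.+1).
Proof.
move=> n_gt0; pose B k w := (C w && indec (lows k.+1 w)) && block k.+1 0 w.
rewrite /num (@count_sum _ _ _ B n).
- apply: eq_bigr => k _; apply: count_insert => //.
    move=> d u d_k u_k /andP[Cd ind_d] Cu; split=> //.
    have [_ _ -> _] := insert_blockP d_k u_k (leq0n _); rewrite ind_d andbT.
    rewrite /insert_block subn0 take_oversize ?size_map // drop_oversize ?size_map // cats0.
    apply: (C_skew (k := k.+1)); rewrite ?all_shift ?C_shift //.
    by apply/allP=> y; rewrite (perms_mem d_k).
  move=> w w_n /andP[Cw ind] _; rewrite ind andbT.
  split; first exact: C_sub (filter_subseq _ _) Cw.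
  by rewrite -(C_shift k.+1) highs_shiftK; apply: C_sub (filter_subseq _ _) Cw.
- move=> w w_n Cw; have [[|k] [] // /andP[_ le_k] bl ind _] := exists_lowest_block w_n n_gt0.
  by exists k => //; rewrite /B Cw bl ind.
- by move=> w k _ _ /andP[/andP[]].
move=> w k k' w_n /andP[lt_k _] /andP[_ bl]; apply/negP=> /andP[/andP[_ ind] bl'].
by have := block_indec_disj _ bl bl'; rewrite ind => /(_ lt_k).
Qed.

End SkewDecomposition.

(** * Words with marked prefix and suffix *)

Lemma inAP w : reflect
  [/\ forall a b c e, subseq [:: a; b; c; e] w -> ~~ p2143 a b c e,
      forall a b c e, subseq [:: a; b; c; e] w -> ~~ p3142 a b c e
    & forall a b c e f g, subseq [:: a; b; c; e; f; g] w -> ~~ p246135 a b c e f g]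
  (inA w).
Proof.
rewrite /inA /avoids_all /= andbT.
by apply: (iffP and3P) => [[/av2143P ? /av3142P ? /av246135P ?] | [? ? ?]];
  split=> //; [exact/av2143P | exact/av3142P | exact/av246135P].
Qed.

(** * Inserting a factor of lowest letters *)

Section InsertLow.

Variables (k : nat) (p d q : seq nat).
Hypotheses (hp : all (leq k) p) (hd : all (gtn k) d) (hq : all (leq k) q).

(** An occurrence puts its first [i] letters in [p] and the next [r] in [d]. Those in [d] must be
    the smallest letters of the pattern and adjacent in it, which leaves few cases. *)
Lemma insert_low_cases t : subseq t (p ++ d ++ q) ->
  exists i r, [/\ i + r <= size t, subseq (take i t) p, subseq (take r (drop i t)) d
    & subseq (drop r (drop i t)) q] /\
  [/\ all (leq k) (take i t), all (gtn k) (take r (drop i t))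
    & all (leq k) (drop r (drop i t))].
Proof.
case/subseq_cat3_split=> i [r [le s1 s2 s3]]; exists i, r; split; split=> //.
- exact: all_subseq s1.
- exact: all_subseq s2.
- exact: all_subseq s3.
Qed.

Hypotheses (sorted_q : sorted ltn q) (A_d : inA d) (A_pq : inA (p ++ q)).
Hypothesis strong_q : forall a b c e,
  subseq [:: a; b; c; e] (p ++ q) -> p2413 a b c e -> c \notin q.

(** If only the 1 or only 21 lies in [d], then 43 is a descent of the increasing word [q]. *)
Lemma insert_2143 a b c e : subseq [:: a; b; c; e] (p ++ d ++ q) -> ~~ p2143 a b c e.
Proof.
have [d1 _ _] := inAP _ A_d; have [pq1 _ _] := inAP _ A_pq.
case/insert_low_cases=> [i [r [[]]]] le s1 s2 s3 [].
have := subseq_sorted ltn_trans s3 sorted_q; have := cat_subseq s1 s3.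
case: i r le s1 s2 s3 => [|[|[|[|[|i]]]]] [|[|[|[|[|r]]]]] //= _ s1 s2 s3 s13 so l1 l2 l3;
  first [exact: d1 | exact: pq1
        | by apply/negP; move: so l1 l2 l3; clear; rewrite /p2143; lia].
Qed.

(** The only proper factor of 3142 made of its smallest letters is 1; if just that lies in [d], then
    42 is a descent of [q]. *)
Lemma insert_3142 a b c e : subseq [:: a; b; c; e] (p ++ d ++ q) -> ~~ p3142 a b c e.
Proof.
have [_ d2 _] := inAP _ A_d; have [_ pq2 _] := inAP _ A_pq.
case/insert_low_cases=> [i [r [[]]]] le s1 s2 s3 [].
have := subseq_sorted ltn_trans s3 sorted_q; have := cat_subseq s1 s3.
case: i r le s1 s2 s3 => [|[|[|[|[|i]]]]] [|[|[|[|[|r]]]]] //= _ s1 s2 s3 s13 so l1 l2 l3;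
  first [exact: d2 | exact: pq2
        | by apply/negP; move: so l1 l2 l3; clear; rewrite /p3142; lia].
Qed.

Lemma insert_246135 a b c e f g :
  subseq [:: a; b; c; e; f; g] (p ++ d ++ q) -> ~~ p246135 a b c e f g.
Proof.
have [_ _ d3] := inAP _ A_d; have [_ _ pq3] := inAP _ A_pq.
case/insert_low_cases=> [i [r [[]]]] le s1 s2 s3 [].
have := subseq_sorted ltn_trans s3 sorted_q; have := cat_subseq s1 s3.
case: i r le s1 s2 s3 => [|[|[|[|[|[|[|i]]]]]]] [|[|[|[|[|[|[|r]]]]]]] //=
  _ s1 s2 s3 s13 so l1 l2 l3;
  first [exact: d3 | exact: pq3
        | by apply/negP; move: so l1 l2 l3; clear; rewrite /p246135; lia | idtac].
(* The remaining case has 246 in [p], 1 in [d] and 35 in [q]. Then 4635 is an occurrence of 2413 in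
   [p ++ q] whose 1 is in [q]. *)
apply/negP=> pat; have := @strong_q b c f g.
have -> : p2413 b c f g by move: pat; clear; rewrite /p246135 /p2413; lia.
have sub : subseq [:: b; c; f; g] (p ++ q).
  by apply: subseq_trans s13; apply: subseq_cons.
by rewrite (mem_subseq s3) ?mem_head // => /(_ sub isT).
Qed.

Lemma inA_insert : inA (p ++ d ++ q).
Proof.
by apply/inAP; split; [exact: insert_2143 | exact: insert_3142 | exact: insert_246135].
Qed.

End InsertLow.

(* In an occurrence of 2413, entry 1 is the letter 4 and entry 2 the letter 1. *)
Definition niceW (X V C : seq nat) :=
  [&& sorted ltn (X ++ C), inA (X ++ V ++ C)
    & all (fun t => order_iso t [:: 2; 4; 1; 3] ==>
           ((nth 0 t 1 \notin X) && (nth 0 t 2 \notin C))) (subs (X ++ V ++ C))].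

Lemma niceWP X V C : reflect
  [/\ sorted ltn (X ++ C), inA (X ++ V ++ C)
    & forall a b c e, subseq [:: a; b; c; e] (X ++ V ++ C) -> p2413 a b c e ->
        (b \notin X) && (c \notin C)]
  (niceW X V C).
Proof.
apply: (iffP and3P) => [[so A_w /allP H]|[so A_w H]]; split=> //.
  move=> a b c e sub pat; have := H [:: a; b; c; e].
  by rewrite mem_subs iso2413 pat; apply.
apply/allP=> t; rewrite mem_subs => sub; apply/implyP=> iso.
have [sz _] := order_isoP _ _ iso.
move: sz sub iso; case: t => [|a [|b [|c [|e []]]]] //= _.
by rewrite iso2413 => /H.
Qed.

Lemma sorted_cat_ltn (s1 s2 : seq nat) x y :
  sorted ltn (s1 ++ s2) -> x \in s1 -> y \in s2 -> x < y.
Proof.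
rewrite (sorted_pairwise ltn_trans) pairwise_cat => /and3P[/allrelP lt12 _ _].
exact: lt12.
Qed.

(** A new occurrence of 2413 either lies in [d], or has just its 1 in [d] and its 3 in [C]. In the
    latter case its 4 exceeds a letter of [C], so it is not in [X]. *)
Lemma niceW_insert k X V C d :
  all (leq k) (X ++ V ++ C) -> all (gtn k) d -> inA d ->
  niceW X V C -> niceW X (V ++ d) C.
Proof.
rewrite !all_cat => /and3P[hX hV hC] hd A_d /niceWP[so A_w st].
have hXV : all (leq k) (X ++ V) by rewrite all_cat hX.
have so_C : sorted ltn C by apply: subseq_sorted so; [exact: ltn_trans | exact: suffix_subseq].
have eqw : X ++ (V ++ d) ++ C = (X ++ V) ++ d ++ C by rewrite !catA.
apply/niceWP; rewrite eqw; split=> //.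
  apply: (inA_insert hXV hd hC) => //; first by rewrite -catA.
  by move=> a b c e; rewrite -catA => /st H /H /andP[].
move=> a b c e /(insert_low_cases hXV hd hC) [i [r [[]]]] le s1 s2 s3 [].
have := cat_subseq s1 s3; rewrite -catA.
have X_k x : x \in X -> k <= x by move/(allP hX).
have C_k x : x \in C -> k <= x by move/(allP hC).
have XC x y : x \in X -> y \in C -> x < y by apply: sorted_cat_ltn so.
case: i r le s1 s2 s3 => [|[|[|[|[|i]]]]] [|[|[|[|[|r]]]]] //= _ s1 s2 s3 s13 l1 l2 l3 pat;
  first [exact: (st _ _ _ _ s13 pat)
        | exfalso; move: l1 l2 l3 pat; clear; rewrite /p2413; lia | idtac].
  by apply/andP; split; [apply/negP=> /X_k | apply/negP=> /C_k]; move: l2; clear; lia.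
apply/andP; split; apply/negP=> [bX]; last by move: bX => /C_k; move: l2; clear; lia.
have eC : e \in C by apply: (mem_subseq s3); rewrite mem_head.
by have := XC _ _ bX eC; move: pat; clear; rewrite /p2413; lia.
Qed.

Lemma niceW_sub X V V' C : subseq V' V -> niceW X V C -> niceW X V' C.
Proof.
move=> sub /niceWP[so A_w st].
have sub_w : subseq (X ++ V' ++ C) (X ++ V ++ C).
  by rewrite subseq_cat2l subseq_cat2r.
apply/niceWP; split=> //; first exact: avoids_all_subseq A_w.
by move=> a b c e /subseq_trans/(_ sub_w)/st.
Qed.

(** Releasing letters of the suffix into the middle only weakens the conditions. *)
Lemma niceW_shorten X V C1 C2 : niceW X V (C1 ++ C2) -> niceW X (V ++ C1) C2.
Proof.
case/niceWP=> so A_w st; apply/niceWP; rewrite -catA; split=> //.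
  apply: subseq_sorted so; first exact: ltn_trans.
  by rewrite subseq_cat2l suffix_subseq.
by move=> a b c e /st H /H; rewrite mem_cat => /andP[-> /norP[]].
Qed.

Lemma niceW_mono (f : nat -> nat) X V C : {mono f : x y / x < y} ->
  niceW (map f X) (map f V) (map f C) = niceW X V C.
Proof.
move=> fm; have f_inj : injective f.
  move=> x y eq_f; have := fm x y; have := fm y x; rewrite eq_f ltnn; lia.
rewrite /niceW /inA -!map_cat avoids_all_mono // subs_map all_map sorted_map.
rewrite (eq_sorted (e' := ltn)); last by move=> x y; apply: fm.
congr [&& _, _ & _]; apply: eq_all => t /=; rewrite order_iso_mono //.
case: (boolP (order_iso _ _)) => //= /order_isoP[sz _].
by rewrite !(nth_map 0) ?sz // !mem_map.
Qed.

(** No pattern begins with its smallest letter, so a leading minimum takes part in no occurrence. *)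
Lemma niceW_cons0 X V C :
  niceW (0 :: map (addn 1) X) (map (addn 1) V) (map (addn 1) C) = niceW X V C.
Proof.
rewrite -(niceW_mono X V C (addn_mono 1)).
move: (all_shift 1 X) (all_shift 1 V) (all_shift 1 C).
move: (map _ X) (map _ V) (map _ C) => {}X {}V {}C hX hV hC.
have hXC : all (leq 1) (X ++ C) by rewrite all_cat hX.
apply/niceWP/niceWP => /= -[so A_w st].
  split.
  - exact: path_sorted so.
  - by apply: avoids_all_subseq A_w; apply: subseq_cons.
  - move=> a b c e sub pat.
    have /st/(_ pat) : subseq [:: a; b; c; e] (0 :: X ++ V ++ C).
      by apply: subseq_trans sub _; apply: subseq_cons.
    by rewrite inE negb_or => /andP[/andP[_ ->] ->].
have [A1 A2 A3] := inAP _ A_w.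
split.
- by rewrite (path_sortedE ltn_trans) so andbT; apply: sub_all hXC.
- apply/inAP; split.
  + move=> a b c e /=; case: eqP => [->|_ /A1//]; rewrite /p2143; lia.
  + move=> a b c e /=; case: eqP => [->|_ /A2//]; rewrite /p3142; lia.
  + move=> a b c e f g /=; case: eqP => [->|_ /A3//]; rewrite /p246135; lia.
move=> a b c e /=; case: eqP => [->|_ sub pat]; first by rewrite /p2413; lia.
have /andP[bX ->] := st _ _ _ _ sub pat; rewrite inE negb_or bX !andbT.
by move: pat; rewrite /p2413; lia.
Qed.

(** * Reverse-complement symmetry *)

Definition compl n w := map (fun y => n.-1 - y) w.

Definition rc n w := rev (compl n w).

Lemma rc_cat n u v : rc n (u ++ v) = rc n v ++ rc n u.
Proof. by rewrite /rc /compl map_cat rev_cat. Qed.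

Lemma rcK n w : all (gtn n) w -> rc n (rc n w) = w.
Proof.
move=> /allP lt_w; rewrite /rc /compl map_rev revK -map_comp map_id_in // => y /lt_w /=; lia.
Qed.

Lemma size_rc n w : size (rc n w) = size w.
Proof. by rewrite size_rev size_map. Qed.

Lemma subseq_rc n t w : subseq t (rc n w) -> exists2 t', subseq t' w & t = rc n t'.
Proof.
rewrite -[t]revK /rc /compl subseq_rev => /subseqP[m _ ->].
by exists (mask m w); rewrite ?mask_subseq // map_mask.
Qed.

Lemma subseq_rc4 n a b c e w : subseq [:: a; b; c; e] (rc n w) ->
  exists a' b' c' e', subseq [:: a'; b'; c'; e'] w /\
    [:: a; b; c; e] = [:: n.-1 - e'; n.-1 - c'; n.-1 - b'; n.-1 - a'].
Proof.
case/subseq_rc=> t sub eq_t; have := congr1 size eq_t; rewrite size_rc.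
case: t sub eq_t => [|a' [|b' [|c' [|e' []]]]] // sub eq_t _.
by exists a', b', c', e'.
Qed.

Lemma subseq_rc6 n a b c e f g w : subseq [:: a; b; c; e; f; g] (rc n w) ->
  exists a' b' c' e' f' g', subseq [:: a'; b'; c'; e'; f'; g'] w /\
    [:: a; b; c; e; f; g] =
    [:: n.-1 - g'; n.-1 - f'; n.-1 - e'; n.-1 - c'; n.-1 - b'; n.-1 - a'].
Proof.
case/subseq_rc=> t sub eq_t; have := congr1 size eq_t; rewrite size_rc.
case: t sub eq_t => [|a' [|b' [|c' [|e' [|f' [|g' []]]]]]] // sub eq_t _.
by exists a', b', c', e', f', g'.
Qed.

(** Reverse-complement fixes 2143, 3142, 246135 and 2413; it exchanges the 4 and the 1 of 2413 just
    as it exchanges [X] and [C]. The bound [n] makes the truncated subtraction strictly decreasing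
    on letters. *)
Lemma niceW_rc n X V C : all (gtn n) (X ++ V ++ C) ->
  niceW X V C -> niceW (rc n C) (rc n V) (rc n X).
Proof.
move=> lt_n /niceWP[so A_w st]; have [A1 A2 A3] := inAP _ A_w.
have lt_t t : subseq t (X ++ V ++ C) -> all (gtn n) t by apply: all_subseq.
have eqw : rc n C ++ rc n V ++ rc n X = rc n (X ++ V ++ C) by rewrite !rc_cat catA.
apply/niceWP; rewrite eqw; split.
- rewrite -rc_cat rev_sorted sorted_map.
  have /allP lt_XC : all (gtn n) (X ++ C).
    by move: lt_n; rewrite !all_cat => /and3P[-> _ ->].
  apply: (sub_in_sorted (P := [in X ++ C])) so; last exact: allss.
  by move=> x y /lt_XC + /lt_XC /=; lia.
- apply/inAP; split.
  + move=> a b c e /subseq_rc4[a' [b' [c' [e' [sub]]]]].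
    case=> -> -> -> ->; have := A1 _ _ _ _ sub; have := lt_t _ sub.
    by rewrite /p2143 /=; lia.
  + move=> a b c e /subseq_rc4[a' [b' [c' [e' [sub]]]]].
    case=> -> -> -> ->; have := A2 _ _ _ _ sub; have := lt_t _ sub.
    by rewrite /p3142 /=; lia.
  + move=> a b c e f g /subseq_rc6[a' [b' [c' [e' [f' [g' [sub]]]]]]].
    case=> -> -> -> -> -> ->; have := A3 _ _ _ _ _ _ sub; have := lt_t _ sub.
    by rewrite /p246135 /=; lia.
move=> a b c e /subseq_rc4[a' [b' [c' [e' [sub]]]]].
case=> -> -> -> -> pat; have := lt_t _ sub; rewrite /= => lt4.
have /st-/(_ sub)/andP[b'X c'C] : p2413 a' b' c' e' by move: pat lt4; rewrite /p2413; lia.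
have notin y s : all (gtn n) s -> y < n -> y \notin s ->
    n.-1 - y \notin rev (map (fun y => n.-1 - y) s).
  move=> /allP lt_s lt_y; apply: contra; rewrite mem_rev => /mapP[z z_s eq_z].
  by have := lt_s z z_s => /= lt_z; rewrite (_ : y = z) //; lia.
move: lt_n; rewrite !all_cat => /and3P[ltX ltV ltC].
by rewrite !notin //; lia.
Qed.

(** The inequality keeps the marked prefix and suffix from overlapping. *)
Definition nice i j w := (i + j <= size w) &&
  niceW (take i w) (take (size w - i - j) (drop i w)) (drop (size w - j) w).

Lemma nice_cat X V C : nice (size X) (size C) (X ++ V ++ C) = niceW X V C.
Proof.
rewrite /nice !size_cat (_ : _ <= _); last by lia.
rewrite take_size_cat // drop_size_cat //.
rewrite (_ : _ - _ - _ = size V); last by lia.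
rewrite (_ : _ - _ = size (X ++ V)); last by rewrite size_cat; lia.
by rewrite take_size_cat // catA drop_size_cat.
Qed.

Lemma niceP i j w : nice i j w ->
  exists X V C, [/\ w = X ++ V ++ C, size X = i, size C = j & niceW X V C].
Proof.
case/andP=> le nW.
exists (take i w), (take (size w - i - j) (drop i w)), (drop (size w - j) w).
split=> //; last by rewrite size_drop; lia.
  have -> : drop (size w - j) w = drop (size w - i - j) (drop i w).
    by rewrite drop_drop; congr drop; lia.
  by rewrite !cat_take_drop.
by rewrite size_takel; lia.
Qed.

Lemma nice_shorten i j w : nice i j.+1 w -> nice i j w.
Proof.
case/niceP=> X [V [[|c C] [-> <- // sz_C nW]]]; case: sz_C => <-.
rewrite -cat_rcons -cats1 nice_cat; apply: niceW_shorten; exact: nW.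
Qed.

Lemma cat_eq_split (T : Type) (a b c e : seq T) : a ++ b = c ++ e ->
  size a <= size c -> exists f, c = a ++ f /\ b = f ++ e.
Proof.
elim: a c => [|x a IHa] [|y c] //=; [by exists [::] | by exists (y :: c) |].
by case=> -> /IHa IH /IH[f [-> ->]]; exists f.
Qed.

Lemma count_split (T : Type) (P Q : pred T) s :
  count P s = count (fun x => P x && Q x) s + count (fun x => P x && ~~ Q x) s.
Proof.
by elim: s => //= x s ->; case: (P x); case: (Q x) => /=; lia.
Qed.

(** * The numbers [N i j n] and their recurrences *)

Definition num_nice i j n := count (nice i j) (perms n).
(** The part of [num_nice] from words that do not begin with their minimum; the default of [head]
    excludes the empty word. *)
Definition num_nice_pos i j n := count (fun w => nice i j w && (head 0 w != 0)) (perms n).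

Lemma rc_perms n w : w \in perms n -> rc n w \in perms n.
Proof.
move=> w_n; apply: perms_intro.
  rewrite rev_uniq map_inj_in_uniq ?(perms_uniq w_n) // => x y.
  by rewrite !(perms_mem w_n) !inE; lia.
move=> y; rewrite mem_rev; apply/mapP/idP => [[x]|lt_y].
  by rewrite (perms_mem w_n) !inE => ? ->; lia.
by exists (n.-1 - y); rewrite ?(perms_mem w_n); move: lt_y; rewrite !inE; lia.
Qed.

Lemma perms_lt n w : w \in perms n -> all (gtn n) w.
Proof. by move=> w_n; apply/allP=> y; rewrite (perms_mem w_n). Qed.

Lemma nice_rc i j n w : w \in perms n -> nice i j w -> nice j i (rc n w).
Proof.
move=> w_n nw; have := perms_lt w_n; have [X [V [C [-> <- <-]]]] := niceP nw => nW lt_n.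
rewrite !rc_cat -catA -(size_rc n X) -(size_rc n C) nice_cat; exact: niceW_rc.
Qed.

Lemma num_nice_sym i j n : num_nice i j n = num_nice j i n.
Proof.
by apply: (@count_bij _ _ _ _ _ _ (rc n) (rc n)); rewrite ?permutations_uniq // => w w_n nw;
  split; [exact: rc_perms | exact: nice_rc | apply/rcK/perms_lt
         |exact: rc_perms | exact: nice_rc | apply/rcK/perms_lt ].
Qed.

(** A leading 0 can be removed and restored by [niceW_cons0]. *)
Lemma num_niceS i j n :
  num_nice i.+1 j n.+1 = num_nice i j n + num_nice_pos i.+1 j n.+1.
Proof.
rewrite {1}/num_nice (count_split _ (fun w => head 0 w == 0)); congr (_ + _).
apply: (@count_bij _ _ _ _ _ _ (fun w => map (subn^~ 1) (behead w))
  (fun u => 0 :: map (addn 1) u));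
  rewrite ?permutations_uniq // => w w_n.
  case/andP=> nw /eqP; have := nw; case/niceP=> -[|x X] [V [C [eq_w // sz_X sz_C nW]]].
  rewrite eq_w /= => eq_x; move: eq_w nW; rewrite eq_x => eq_w nW.
  have un := perms_uniq w_n; rewrite eq_w /= in un; have /andP[n0 un'] := un.
  have shift s : {subset s <= X ++ V ++ C} -> map (addn 1) (map (subn^~ 1) s) = s.
    move=> sub; rewrite -map_comp map_id_in // => y /sub y_in /=; rewrite subnKC //.
    by rewrite lt0n; apply: contraNneq n0 => <-.
  have sX : {subset X <= X ++ V ++ C} by move=> y yX; rewrite mem_cat yX.
  have sV : {subset V <= X ++ V ++ C} by move=> y yX; rewrite !mem_cat yX orbT.
  have sC : {subset C <= X ++ V ++ C} by move=> y yX; rewrite !mem_cat yX !orbT.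
  split; last by rewrite shift.
    apply: perms_intro.
      by rewrite -(map_inj_uniq (@addnI 1)) shift.
    move=> y; rewrite -(mem_map (@addnI 1)) shift //.
    have := perms_mem w_n (1 + y); rewrite eq_w inE /= => ->.
    by rewrite !inE; lia.
  move: sz_X => /= [<-]; rewrite -sz_C !map_cat.
  rewrite -(size_map (subn^~ 1) X) -(size_map (subn^~ 1) C) nice_cat.
  by rewrite -niceW_cons0 !shift.
case/niceP=> X [V [C [eq_w <- <- nW]]]; split.
- apply: perms_intro => /=.
    rewrite map_inj_uniq ?(perms_uniq w_n) ?andbT; last exact: addnI.
    by apply/mapP=> -[].
  move=> [|y]; rewrite inE //= (mem_map (@addnI 1) w y) (perms_mem w_n) !inE; lia.
- rewrite eqxx andbT eq_w !map_cat -cat_cons.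
  rewrite -(size_map (addn 1) X) -(size_map (addn 1) C).
  by rewrite -[(size _).+1]/(size (0 :: map (addn 1) X)) nice_cat niceW_cons0.
by rewrite /= -map_comp map_id_in // => y _ /=; rewrite addKn.
Qed.

Lemma niceW_unshift k X V C : all (leq k) (X ++ V ++ C) -> niceW X V C ->
  niceW (map (subn^~ k) X) (map (subn^~ k) V) (map (subn^~ k) C).
Proof.
rewrite !all_cat => /and3P[hX hV hC] nW; rewrite -(niceW_mono _ _ _ (addn_mono k)).
have shift s : all (leq k) s -> map (addn k) (map (subn^~ k) s) = s.
  by move=> /allP hs; rewrite -map_comp map_id_in // => y /hs /= le; rewrite subnKC.
by rewrite !shift.
Qed.

(** For [i > 0] and [k > 0] this makes [lows k w] the lowest skew component of the letters below the
    first one, with only the marked suffix after it. *)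
Definition low_block i j k w :=
  (nice i j w && (k <= head 0 w) && indec (lows k w)) && block k j w.

Lemma low_block_remove i j k n w : k <= n -> w \in perms n -> nice i.+1 j w ->
  k <= head 0 w -> indec (lows k w) -> block k j w -> 0 < k ->
  (inA (lows k w) && indec (lows k w)) /\ nice i.+1 j (map (subn^~ k) (highs k w)).
Proof.
move=> le_kn w_n nw le_head ind bl k_gt0.
have [[|x X] [V [C [eq_w // sz_X sz_C nW]]]] := niceP nw.
have [so A_w _] := niceWP _ _ _ nW; split.
  by rewrite ind andbT; apply: avoids_all_subseq (filter_subseq _ _) _; rewrite eq_w.
have sz_w := perms_size w_n; have szl := perms_size (lows_perms w_n le_kn).
have hX : all (leq k) (x :: X).
  have le_kx : k <= x by move: le_head; rewrite eq_w.
  move: so; rewrite /= le_kx (path_sortedE ltn_trans) all_cat => /andP[/andP[/allP ltX _] _].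
  by apply/allP=> y /ltX /=; lia.
have /andP[le_jk /eqP eq_l] := bl; have /andP[h1 h2] := block_highs w_n bl.
have eq_sz : size w = size (x :: X) + size V + j by rewrite eq_w !size_cat sz_C addnA.
have szT : size (take (size w - j - k) w) = size w - j - k.
  by rewrite size_takel //; clear; lia.
have eqC : drop (size w - j) w = C.
  by rewrite eq_sz addnK eq_w catA drop_size_cat // size_cat.
have e1 : size ((x :: X) ++ V) = size (take (size w - j - k) w ++ lows k w).
  by rewrite !size_cat szT szl; move: le_jk eq_sz; clear; lia.
have eqXV : (x :: X) ++ V = take (size w - j - k) w ++ lows k w.
  have := block_cat bl; rewrite eqC {1}eq_w !catA => /eqP.
  by rewrite (eqseq_cat _ _ e1) eqxx andbT => /eqP.
(* The block starts after the prefix: otherwise its first letter would be a prefix letter, hence at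
   least [k]. *)
have le_i : size (x :: X) <= size w - j - k.
  rewrite leqNgt; apply/negP=> lt_i.
  have := allP hX _ (mem_nth 0 lt_i); have := nth_cat 0 (x :: X) V (size w - j - k).
  rewrite lt_i => <-.
  rewrite eqXV nth_cat szT ltnn subnn => le_k; have: nth 0 (lows k w) 0 \in lows k w.
    by apply: mem_nth; rewrite szl.
  by rewrite mem_filter ltnNge le_k.
have [|V' [eqT eqV]] := cat_eq_split eqXV; first by rewrite szT.
rewrite (block_highsE w_n bl) eqT eqC -catA !map_cat.
rewrite -sz_X -sz_C -(size_map (subn^~ k) (x :: X)) -(size_map (subn^~ k) C) nice_cat.
apply: niceW_unshift; first by rewrite catA all_cat -eqT h1 -eqC.
by apply: niceW_sub nW; rewrite eqV prefix_subseq.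
Qed.

(** By [niceW_insert] any indecomposable [d] in the class may be inserted just before the suffix,
    and [low_block_remove] undoes this. *)
Lemma count_low_block i j k n : 0 < k <= n ->
  count (low_block i.+1 j k) (perms n) =
  num_indec inA k * num_nice i.+1 j (n - k).
Proof.
case/andP=> k_gt0 le_kn; apply: count_insert => // [d u d_k u_k | w w_n].
  case/andP=> A_d ind_d nu; have := nu; case/niceP=> -[|x X] [V [C [eq_u // sz_X sz_C nW]]].
  have sz_u := perms_size u_k.
  have le_j : j <= n - k by rewrite -sz_u eq_u !size_cat; lia.
  split=> //; have [_ _ -> _] := insert_blockP d_k u_k le_j; rewrite ind_d andbT.
  pose f := map (addn k).
  have -> : insert_block k j d u = f (x :: X) ++ (f V ++ d) ++ f C.
    rewrite /insert_block eq_u [(x :: X) ++ V ++ C]catA map_cat.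
    rewrite (_ : size _ - j = size (map (addn k) ((x :: X) ++ V))); last first.
      by rewrite size_map !size_cat; lia.
    by rewrite take_size_cat // drop_size_cat // map_cat -!catA.
  rewrite /= leq_addr andbT -sz_X -sz_C -(size_map (addn k) (x :: X)) -(size_map (addn k) C).
  rewrite -cat_cons -[_ :: f X]/(f (x :: X)) nice_cat.
  apply: (niceW_insert (k := k)) => //; last by rewrite niceW_mono //; apply: addn_mono.
    by rewrite -!map_cat all_shift.
  exact: perms_lt d_k.
by case/andP=> /andP[nw le_head] ind bl; apply: low_block_remove w_n _ _ _ _ _.
Qed.

(** * Removing the lowest component below the first letter *)

Lemma block_end m k u (y z : nat) : u \in perms m -> block k 0 u ->
  subseq [:: y; z] u -> y < k -> z < k.
Proof.
move=> u_m bl; have /andP[hp _] := block_highs u_m bl.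
rewrite subn0 in hp.
rewrite {1}[u](block_cat bl) drop_oversize ?cats0 ?subn0 // => /subseq_cat_split.
have hl : all (gtn k) (lows k u) := filter_all _ _.
case=> -[|[|i]] [_ s1 s2] lt_y.
- by have /= := all_subseq hl s2; move: lt_y; clear; lia.
- by have /= := all_subseq hp s1; move: lt_y; clear; lia.
by have /= := all_subseq hp s1; move: lt_y; clear; lia.
Qed.

(** A letter of [v1] has all [size v2] letters of [v2] below it; a letter [y] of [v2] has all of 0,
    ..., [y] in [v2], so [y < size v2]. *)
Lemma perms_cut m v1 v2 : v1 ++ v2 \in perms m ->
  (forall x y, x \in v1 -> y \in v2 -> y < x) ->
  all (leq (size v2)) v1 /\ block (size v2) 0 (v1 ++ v2).
Proof.
move=> v_m lt_v; have un := perms_uniq v_m; have v_mem := perms_mem v_m.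
move: un; rewrite cat_uniq => /and3P[_ _ un2].
have h1 : all (leq (size v2)) v1.
  apply/allP=> x xv; rewrite -[X in _ <= X](size_iota 0).
  by apply: uniq_leq_size => // y yv; rewrite mem_iota /=; apply: lt_v.
have h2 : all (gtn (size v2)) v2.
  apply/allP=> y yv /=; rewrite -[X in X <= _](size_iota 0 y.+1).
  apply: uniq_leq_size; rewrite ?iota_uniq // => z; rewrite mem_iota /= => le_zy.
  have: z \in v1 ++ v2.
    have: y \in v1 ++ v2 by rewrite mem_cat yv orbT.
    by rewrite !v_mem !inE; move: le_zy; clear; lia.
  rewrite mem_cat => /orP[/lt_v/(_ yv)|//]; move: le_zy; clear; lia.
split=> //; have := @block_catl (size v2) v1 v2 [::] h1 h2 isT erefl.
by rewrite cats0.
Qed.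

Lemma convex_filter (a : pred nat) v :
  (forall y r z, a y -> a z -> subseq [:: y; r; z] v -> a r) ->
  exists p q, [/\ v = p ++ filter a v ++ q, ~~ has a p & ~~ has a q].
Proof.
elim: v => [|x v IHv] cvx; first by exists [::], [::].
have [|p [q [eq_v p_a q_a]]] := IHv.
  move=> y r z ay az sub; apply: (cvx y r z) => //.
  exact: subseq_trans sub (subseq_cons _ _).
case: (boolP (a x)) => [ax|nax]; last first.
  by exists (x :: p), q; rewrite /= (negbTE nax) -eq_v.
case: (boolP (has a v)) => [/hasP[z z_v az]|no_a]; last first.
  exists [::], v; split=> //; rewrite /= ax (_ : filter a v = [::]) //.
  by apply/eqP; rewrite -[_ == _]negbK -has_filter.
exists [::], q; split=> //; rewrite /= ax {1}eq_v.
case: p p_a eq_v => // r p; rewrite /= negb_or => /andP[nar _] eq_v.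
case/negP: nar; apply: (cvx x r z) => //; rewrite /= eqxx eq_v /= eqxx sub1seq.
by rewrite !mem_cat mem_filter az z_v orbT.
Qed.

Lemma sorted_of_subseq q : (forall y z, subseq [:: y; z] q -> y < z) -> sorted ltn q.
Proof.
elim: q => //= x q IHq lt_q; rewrite (path_sortedE ltn_trans); apply/andP; split.
  by apply/allP=> y y_q; apply: lt_q; rewrite eqxx sub1seq.
apply: IHq => y z sub; apply: lt_q; case: ifP => // _.
by rewrite sub1seq; apply: (mem_subseq sub); rewrite inE mem_head orbT.
Qed.

Section LowestBlock.

Variables (n x : nat) (X V C : seq nat).
Hypothesis w_n : (x :: X) ++ V ++ C \in perms n.
Hypothesis nW : niceW (x :: X) V C.
Hypothesis x_gt0 : 0 < x.

Let w := (x :: X) ++ V ++ C.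

(** Otherwise [x], [y], [r], [z] would form 2143. *)
Lemma ascend_above_head (y r z : nat) :
  subseq [:: y; r; z] (V ++ C) -> y < x -> x < r -> x < z -> r < z.
Proof.
move=> sub lt_y lt_r lt_z; have [_ A_w _] := niceWP _ _ _ nW.
have [A1 _ _] := inAP _ A_w.
have : subseq [:: x; y; r; z] w.
  by rewrite /w /= eqxx; apply: subseq_trans sub _; apply: suffix_subseq.
move=> sub4; have := A1 _ _ _ _ sub4; have : r != z.
  have := subseq_uniq sub4 (perms_uniq w_n); rewrite /= !inE; clear; lia.
by rewrite /p2143; move: lt_y lt_r lt_z; clear; lia.
Qed.

(** Otherwise [x], [y], [r], [z] would form 3142. *)
Lemma descend_below_head (y r z : nat) :
  subseq [:: y; r; z] (V ++ C) -> z < x -> x < r -> z < y.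
Proof.
move=> sub lt_z lt_r; have [_ A_w _] := niceWP _ _ _ nW.
have [_ A2 _] := inAP _ A_w.
have : subseq [:: x; y; r; z] w.
  by rewrite /w /= eqxx; apply: subseq_trans sub _; apply: suffix_subseq.
move=> sub4; have := A2 _ _ _ _ sub4; have : y != z.
  have := subseq_uniq sub4 (perms_uniq w_n); rewrite /= !inE; clear; lia.
by rewrite /p3142; move: lt_z lt_r; clear; lia.
Qed.

(** A prefix letter [t > z] would make [x], [t], [y], [z] a 2413 with its 4 in the prefix. *)
Lemma above_prefix (y z : nat) : subseq [:: y; z] (V ++ C) -> y < x -> x < z ->
  all (gtn z) (x :: X).
Proof.
move=> sub lt_y lt_z; apply/allP=> t t_X /=.
have [so _ st] := niceWP _ _ _ nW.
case: (t =P x) => [->//|/eqP t_x].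
have sub_t : subseq [:: t] X by rewrite sub1seq; move: t_X; rewrite inE (negPf t_x).
have sub4 : subseq ([:: x; t] ++ [:: y; z]) w.
  by apply: cat_subseq sub; rewrite /= eqxx.
have : t != z.
  have := subseq_uniq sub4 (perms_uniq w_n); rewrite /= !inE; clear; lia.
have := st _ _ _ _ sub4; rewrite t_X /p2413; move: lt_y lt_z; clear; lia.
Qed.

Lemma lows_w k : k <= x -> lows k w = lows k V.
Proof.
move=> le_k; have [so _ _] := niceWP _ _ _ nW.
have h : all (leq x) ((x :: X) ++ C).
  rewrite /= leqnn; move: so; rewrite /= (path_sortedE ltn_trans) => /andP[lt _].
  by apply: sub_all lt => y /= /ltnW.
have low0 s : subseq s ((x :: X) ++ C) -> lows k s = [::].
  move=> /(all_subseq h) /allP hs; rewrite /lows -(filter_pred0 s).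
  by apply: eq_in_filter => y /hs /=; move: le_k; clear; lia.
rewrite /w /lows !filter_cat -/(lows k (x :: X)) -/(lows k C) !low0 ?cats0 //.
  exact: suffix_subseq.
exact: prefix_subseq.
Qed.

(** The witness [k] is the size of the lowest skew component of the letters below [x]. Its letters
    are consecutive in [V], and the letters [q] between it and [C] can join the suffix: 2143 makes
    [q ++ C] increasing, the condition on the 4 of 2413 puts it above the prefix, and 246135 keeps
    the 1 of any 2413 out of it. *)
Lemma exists_suffix_block : exists k p q,
  [/\ 0 < k <= x, V = p ++ lows k w ++ q, all (leq k) (p ++ q), indec (lows k w)
    & niceW (x :: X) (p ++ lows k w) (q ++ C)].
Proof.
have [so A_w st] := niceWP _ _ _ nW; have un := perms_uniq w_n.
have lt_xn : x < n by have := perms_mem w_n x; rewrite mem_head inE.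
have D_x := lows_perms w_n (ltnW lt_xn); rewrite -/w in D_x.
have [k [/andP[k_gt0 le_kx] bl ind min_k]] := exists_lowest_block D_x x_gt0.
rewrite lows_lows // in ind.
have eqD : lows x w = lows x V by apply: lows_w.
have subV : subseq V (V ++ C) := prefix_subseq _ _.
have subV_w : subseq V w by apply: subseq_trans subV (suffix_subseq _ _).
have notx r : r \in V ++ C -> r != x.
  by move=> r_V; apply/eqP=> eq_r; move: un; rewrite /= mem_cat -eq_r r_V orbT.
(* A letter [r > x] inside the block would be a skew cut of it: avoiding 3142 puts
   the letters below [x] after [r] under those before [r]. *)
have cvx y r z : y < k -> z < k -> subseq [:: y; r; z] V -> r < k.
  move=> lt_y lt_z sub; have r_V : r \in V by apply: (mem_subseq sub); rewrite !inE eqxx orbT.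
  have r_x : r != x by apply: notx; rewrite mem_cat r_V.
  (* Among the letters below [x] the block comes last, so [r < x] after [y] stays in the block. *)
  case: (ltnP r x) => [lt_rx|le_xr].
    apply: (block_end D_x bl _ lt_y); rewrite eqD /lows subseq_filter /= lt_rx.
    rewrite (leq_trans lt_y le_kx) /=; apply: subseq_trans sub.
    by rewrite (prefix_subseq [:: y; r] [:: z]).
  have lt_xr : x < r by rewrite ltn_neqAle eq_sym r_x.
  have [s1 [s2 eqV]] : exists s1 s2, V = s1 ++ r :: s2.
    by case/splitPr: r_V => s1 s2; exists s1, s2.
  have unV : uniq (s1 ++ r :: s2) by rewrite -eqV; apply: subseq_uniq un; rewrite subV_w.
  move: (sub); rewrite eqV -[[:: y; r; z]]/([:: y] ++ r :: [:: z]) uniq_subseq_pivot //.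
  rewrite !sub1seq => /andP[y_s1 z_s2].
  have eqD' : lows x w = lows x s1 ++ lows x s2.
    by rewrite eqD eqV /lows filter_cat /= ltnNge ltnW.
  have lt_v a b : a \in lows x s1 -> b \in lows x s2 -> b < a.
    rewrite !mem_filter => /andP[_ a_s1] /andP[lt_b b_s2].
    apply: (descend_below_head (r := r)) => //; apply: subseq_trans subV; rewrite eqV.
    by rewrite -[[:: a; r; b]]/([:: a] ++ r :: [:: b]) uniq_subseq_pivot // !sub1seq a_s1.
  (* This cut is nonempty because of [z] and has size at most [y < k], against the minimality of
     [k]. *)
  move: (D_x); rewrite eqD' => /perms_cut/(_ lt_v)[/allP h1 blk].
  have y_v1 : y \in lows x s1 by rewrite mem_filter y_s1 (leq_trans lt_y le_kx).
  have z_v2 : z \in lows x s2 by rewrite mem_filter z_s2 (leq_trans lt_z le_kx).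
  have := min_k (size (lows x s2)); rewrite eqD' blk (leq_ltn_trans (h1 y y_v1) lt_y).
  by case: (lows x s2) z_v2 => // ? ? _ /(_ isT).
have [p [q [eqV p_k q_k]]] := convex_filter (a := gtn k) cvx.
have eql : filter (gtn k) V = lows k w by rewrite lows_w.
have hi s : ~~ has (gtn k) s -> all (leq k) s.
  by rewrite -all_predC => /allP hs; apply/allP=> y /hs /=; rewrite -leqNgt.
rewrite eql in eqV; exists k, p, q; split=> //; rewrite ?k_gt0 ?all_cat ?hi //.
have szl : size (lows k w) = k.
  exact: perms_size (lows_perms w_n (leq_trans le_kx (ltnW lt_xn))).
(* A letter [m0] of the block serves below as the 1 of 2143, of 2413 and of 246135. *)
have [m0 m0_l] : exists m0, m0 \in lows k w.
  case: (lows k w) szl => [/= k0|m0 l _]; first by rewrite -k0 in k_gt0.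
  by exists m0; rewrite mem_head.
have lt_m0 : m0 < k by move: m0_l; rewrite mem_filter => /andP[].
have lt_m0x : m0 < x by apply: leq_trans le_kx.
have eqVC : V ++ C = (p ++ lows k w) ++ (q ++ C) by rewrite {1}eqV -!catA.
have sub_m0 t : subseq t (q ++ C) -> subseq (m0 :: t) (V ++ C).
  move=> sub; rewrite eqVC -[m0 :: t]/([:: m0] ++ t) cat_subseq // sub1seq mem_cat m0_l.
  by rewrite orbT.
(* A letter of [q] below [x] would follow [m0] among the letters below [x], hence belong to the
   block. *)
have gt_x y : y \in q ++ C -> x < y.
  move=> y_qC; have y_x : y != x by apply: notx; rewrite eqVC mem_cat y_qC orbT.
  rewrite ltn_neqAle eq_sym y_x leqNgt; apply/negP=> lt_yx.
  move: y_qC; rewrite mem_cat => /orP[y_q|y_C]; last first.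
    by have := sorted_cat_ltn so (mem_head _ _) y_C; move: lt_yx; clear; lia.
  have : y < k.
    apply: (block_end D_x bl _ lt_m0); rewrite eqD /lows subseq_filter /= lt_m0x lt_yx /=.
    rewrite eqV -[[:: m0; y]]/([::] ++ [:: m0] ++ [:: y]).
    by rewrite cat_subseq ?sub0seq // cat_subseq // sub1seq.
  by have := allP (hi _ q_k) y y_q => /=; clear; lia.
have so_q : sorted ltn (q ++ C).
  apply: sorted_of_subseq => y z sub; apply: (ascend_above_head (y := m0)); rewrite ?sub_m0 //.
    by apply: gt_x; apply: (mem_subseq sub); rewrite mem_head.
  by apply: gt_x; apply: (mem_subseq sub); rewrite inE mem_head orbT.
have eqw : (x :: X) ++ (p ++ lows k w) ++ q ++ C = w by rewrite -eqVC.
apply/niceWP; rewrite eqw; split=> //.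
  rewrite (sorted_pairwise ltn_trans) pairwise_cat -!(sorted_pairwise ltn_trans) so_q andbT.
  apply/andP; split; last first.
    by apply: subseq_sorted so; [exact: ltn_trans | exact: prefix_subseq].
  apply/allrelP=> t y t_X y_q; apply: (allP (above_prefix (y := m0) (z := y) _ _ _)) => //.
    by apply: sub_m0; rewrite sub1seq.
  exact: gt_x.
move=> a b c e sub pat; have /andP[-> _] := st _ _ _ _ sub pat; rewrite andTb.
(* As [q ++ C] is increasing and above [x], the letters [a] and [b] must precede the block. Then
   [x], [a], [b], [m0], [c], [e] form 246135. *)
apply/negP=> c_q; have lt_xc := gt_x c c_q.
have eqw' : w = (((x :: X) ++ p) ++ lows k w) ++ (q ++ C) by rewrite -!catA -{1}eqw -!catA.
have [_ _ A3] := inAP _ A_w.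
have /= lt_l := allP (filter_all (gtn k) w : all (gtn k) (lows k w)).
have := sub; rewrite -/w eqw' => /subseq_cat_split[[|[|[|t]]] [_ s1 s2]].
- by have /= := subseq_sorted ltn_trans s2 so_q; move: pat; clear; rewrite /p2413; lia.
- by have /= := subseq_sorted ltn_trans s2 so_q; move: pat; clear; rewrite /p2413; lia.
- case/subseq_cat_split: s1 => -[|[|t]] [_ s11 s12].
  + have := lt_l a; rewrite (mem_subseq s12) ?mem_head // => /(_ isT).
    by move: pat lt_xc le_kx; clear; rewrite /p2413; lia.
  + have := lt_l b; rewrite (mem_subseq s12) ?mem_head // => /(_ isT).
    by move: pat lt_xc le_kx; clear; rewrite /p2413; lia.
  have s3 : subseq [:: x; a; b] ((x :: X) ++ p).
    move: s11; rewrite /= eqxx; case: eqP => [eq_a|//].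
    by move: pat lt_xc; rewrite /p2413 eq_a; clear; lia.
  have : subseq (([:: x; a; b] ++ [:: m0]) ++ [:: c; e]) w.
    by rewrite eqw'; apply: cat_subseq s2; apply: cat_subseq; rewrite ?sub1seq.
  move/A3; rewrite /p246135; move: pat lt_xc lt_m0x; clear; rewrite /p2413; lia.
have c_P : c \in ((x :: X) ++ p) ++ lows k w.
  by apply: (mem_subseq s1); rewrite /= !inE eqxx !orbT.
move: un; rewrite -/w eqw' cat_uniq => /and3P[_ /hasP no _]; apply: no; by exists c.
Qed.

End LowestBlock.

(** In [exists_suffix_block] the word [q] must be empty: otherwise its last letter would extend the
    suffix to length [j.+1]. *)
Lemma exists_low_block i j n w : w \in perms n -> nice i.+1 j w -> head 0 w != 0 ->
  ~~ nice i.+1 j.+1 w -> exists2 k, k < n & low_block i.+1 j k.+1 w.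
Proof.
move=> w_n nw hd nnw; have [[|x X] [V [C [eq_w // sz_X sz_C nW]]]] := niceP nw.
have x_gt0 : 0 < x by move: hd; rewrite eq_w lt0n.
have w_n' := w_n; rewrite eq_w in w_n'.
have [[|k] [p [q]]] := exists_suffix_block w_n' nW x_gt0; first by case.
rewrite -eq_w => -[/andP[_ le_kx] eqV hi ind nW'].
have q0 : q = [::].
  case/lastP: q eqV hi nW' => // q y eqV _ nW'; case/negP: nnw.
  have eq_w' : w = (x :: X) ++ ((p ++ lows k.+1 w) ++ q) ++ y :: C.
    by rewrite {1}eq_w {1}eqV -cats1 -!catA.
  have := nice_cat (x :: X) ((p ++ lows k.+1 w) ++ q) (y :: C).
  rewrite -eq_w' sz_X [size (y :: C)]/= sz_C => ->.
  by apply: niceW_shorten; rewrite -cat_rcons.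
rewrite {}q0 !cats0 in eqV hi nW'.
have lt_xn : x < n by have := perms_mem w_n x; rewrite eq_w mem_head inE.
exists k; first exact: leq_trans le_kx (ltnW lt_xn).
rewrite /low_block nw ind andbT andTb; apply/andP; split; first by rewrite eq_w.
have [so _ _] := niceWP _ _ _ nW.
have hXC : all (leq k.+1) ((x :: X) ++ C).
  rewrite /= le_kx; move: so; rewrite /= (path_sortedE ltn_trans) => /andP[lt _].
  by apply: sub_all lt => y /= /ltnW; apply: leq_trans.
move: hXC; rewrite all_cat => /andP[hX hC].
have eq_w' : w = ((x :: X) ++ p) ++ lows k.+1 w ++ C by rewrite {1}eq_w {1}eqV -!catA.
have := @block_catl k.+1 ((x :: X) ++ p) (lows k.+1 w) C.
rewrite sz_C -eq_w' all_cat hX hi hC; apply=> //; first exact: filter_all.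
exact: perms_size (lows_perms w_n (leq_trans le_kx (ltnW lt_xn))).
Qed.

(** A suffix of length [j.+1] would start with the last letter of the block, which is smaller than
    the first letter of the prefix. *)
Lemma low_block_not_nice i j k n w : w \in perms n -> 0 < k -> low_block i.+1 j k w ->
  (head 0 w != 0) && ~~ nice i.+1 j.+1 w.
Proof.
move=> w_n k_gt0 /andP[/andP[/andP[_ le_k] _] bl].
rewrite -lt0n (leq_trans k_gt0 le_k) /=; apply/negP=> /andP[le_ij /niceWP[so _ _]].
have /andP[le_jk /eqP eql] := bl.
have sz_l : size (lows k w) = k.
  by rewrite eql size_takel // size_drop; move: le_jk; clear; lia.
have in_l : nth 0 (lows k w) k.-1 \in lows k w by apply: mem_nth; rewrite sz_l prednK.
have lt_k : nth 0 (lows k w) k.-1 < k by move: in_l; rewrite mem_filter => /andP[].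
have eq_nth : nth 0 (lows k w) k.-1 = nth 0 (drop (size w - j.+1) w) 0.
  rewrite eql nth_take ?prednK // !nth_drop; congr nth.
  by move: le_jk k_gt0; clear; lia.
have sz_C : 0 < size (drop (size w - j.+1) w).
  by rewrite size_drop; move: le_ij; clear; lia.
have in_C := mem_nth 0 sz_C.
have in_X : head 0 w \in take i.+1 w.
  by case: (w) le_ij => //= x s _; rewrite mem_head.
by have := sorted_cat_ltn so in_X in_C; rewrite -eq_nth; move: le_k lt_k; clear; lia.
Qed.

(** The first term counts the words whose suffix can be extended by one letter, the sum those with a
    block right before the suffix. Iterating in [j] yields the sum over [j'] of the overview. *)
Lemma num_nice_pos_rec i j n : num_nice_pos i.+1 j n =
  num_nice_pos i.+1 j.+1 n + \sum_(k < n) num_indec inA k.+1 * num_nice i.+1 j (n - k.+1).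
Proof.
rewrite {1}/num_nice_pos (count_split _ (nice i.+1 j.+1)); congr (_ + _).
  apply: eq_count => w /=; case: (boolP (nice i.+1 j.+1 w)) => [nw|]; last by rewrite andbF.
  by rewrite (nice_shorten nw) andbT.
rewrite (@count_sum _ _ _ (fun k => low_block i.+1 j k.+1) n).
- by apply: eq_bigr => k _; apply: count_low_block; rewrite ltn_ord.
- by move=> w w_n /andP[/andP[nw hd] nnw]; apply: exists_low_block.
- move=> w k w_n _ lb; have /andP[-> ->] := low_block_not_nice w_n (ltn0Sn _) lb.
  by case/andP: lb => /andP[/andP[->]].
move=> w k k' w_n /andP[lt_k _] /andP[_ bl]; apply/negP=> /andP[/andP[_ ind] bl'].
by have := block_indec_disj _ bl bl'; rewrite ind => /(_ lt_k).
Qed.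

(** * Counting the first class *)

Lemma inA_skew k u v : all (leq k) u -> all (gtn k) v -> inA u -> inA v -> inA (u ++ v).
Proof.
move=> hu hv A_u A_v; rewrite -[u ++ v]cats0 -catA.
by apply: (@inA_insert k u v [::]); rewrite ?cats0.
Qed.

Lemma num_skewA n : 0 < n ->
  num inA n = \sum_(k < n) num_indec inA k.+1 * num inA (n - k.+1).
Proof.
apply: num_skew; [exact: avoids_all_subseq | exact: avoids_all_shift | exact: inA_skew].
Qed.

Section Convolution.

Variable h : nat -> nat.
Definition conv (f : nat -> nat) n := \sum_(k < n) h k.+1 * f (n - k.+1).

Lemma eq_conv f g n : (forall m, m < n -> f m = g m) -> conv f n = conv g n.
Proof. by move=> eq_fg; apply: eq_bigr => k _; rewrite eq_fg //; case: k => k /=; lia. Qed.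

Lemma convD f g n : conv (fun m => f m + g m) n = conv f n + conv g n.
Proof. by rewrite /conv -big_split; apply: eq_bigr => k _; rewrite mulnDr. Qed.

Lemma conv0 f n : (forall m, m < n -> f m = 0) -> conv f n = 0.
Proof.
by move=> f0; rewrite /conv big1 // => k _; rewrite f0 ?muln0 //; case: k => k /=; lia.
Qed.

Lemma conv_shift f g n : g 0 = 0 -> (forall m, g m.+1 = f m) -> conv g n.+1 = conv f n.
Proof.
move=> g0 gS; rewrite /conv big_ord_recr /= subnn g0 muln0 addn0.
by apply: eq_bigr => k _; rewrite -gS; congr (_ * g _); case: k => k /=; lia.
Qed.

End Convolution.

Local Notation convA := (conv (num_indec inA)).

Lemma num_nice_small i j n : n < i + j -> num_nice i j n = 0.
Proof.
move=> lt_n; apply/eqP; rewrite -leqn0 leqNgt -has_count; apply/hasP=> -[w w_n /andP[le _]].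
by move: le; rewrite (perms_size w_n); lia.
Qed.

Lemma num_nice_pos_small i j n : n < i + j -> num_nice_pos i j n = 0.
Proof.
move=> lt_n; apply/eqP; rewrite -leqn0 leqNgt -has_count.
apply/hasP=> -[w w_n /andP[/andP[le _] _]].
by move: le; rewrite (perms_size w_n); lia.
Qed.

Lemma num_nice00 n : num_nice 0 0 n = num inA n.
Proof.
apply: eq_count => w; have := nice_cat [::] w [::]; rewrite /= cats0 => ->.
by apply/niceWP/idP => /= [[_]|A_w]; rewrite cats0 //; split.
Qed.

(** The first letter is never the 4 of a 2413. At length 0 the equality fails: the left side would
    be 0 and the right side 1. *)
Lemma num_nice10 n : num_nice 1 0 n.+1 = num inA n.+1.
Proof.
apply: eq_in_count => -[/perms_size//|x w] w_n; have un := perms_uniq w_n.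
have := nice_cat [:: x] w [::]; rewrite /= cats0 => ->.
apply/niceWP/idP => /= [[_]|A_w]; rewrite cats0 //; split=> // a b c e sub pat.
rewrite inE andbT; apply/eqP=> eq_b; move: un; rewrite /= (_ : x \in w) //.
by apply: (mem_subseq sub); case: ifP => _; rewrite !inE eq_b eqxx ?orbT.
Qed.

(** With the symmetry, this says that [num_nice i j n] depends only on [i + j] and [n]. The terms
    from [num_niceS] and [num_nice_pos_rec] have smaller length, except for those with a longer
    suffix. *)
Lemma num_nice_flip n i j : num_nice i.+2 j n = num_nice i.+1 j.+1 n.
Proof.
elim/ltn_ind: n i j => -[|n] IHn i j; first by rewrite !num_nice_small.
rewrite !num_niceS; congr (_ + _).
  case: i => [|i]; last exact: IHn.
  rewrite (num_nice_sym 0); have chain a b : num_nice a.+1 b n = num_nice 1 (a + b) n.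
    by elim: a b => // a IHa b; rewrite IHn // IHa addnS.
  by rewrite [RHS]chain addn0.
(* Descending induction on [j], with fuel [m]; both counts vanish once the suffix is too long for
   the word. *)
have [m le_m] : exists m, n < m + j by exists n.+1; lia.
elim: m j le_m => [|m IHm] j le_m; first by rewrite !num_nice_pos_small; lia.
rewrite num_nice_pos_rec [RHS]num_nice_pos_rec IHm; last by lia.
by congr (_ + _); apply: eq_bigr => k _; rewrite IHn //; case: k => k /=; lia.
Qed.

(** Both sides satisfy the same recurrences, since convolution commutes with the shift in
    [num_niceS] and with the sum in [num_nice_pos_rec]. *)
Lemma num_nice_conv n i j : num_nice i.+1 j.+1 n = convA (num_nice i.+1 j) n.
Proof.
elim/ltn_ind: n i j => -[|n] IHn i j.
  by rewrite num_nice_small // /conv big_ord0.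
pose f m := if m is m'.+1 then num_nice i j m' else 0.
rewrite num_niceS (@eq_conv _ _ (fun m => f m + num_nice_pos i.+1 j m)); last first.
  by case=> [|m] _; rewrite ?num_niceS // num_nice_small // num_nice_pos_small.
rewrite convD (conv_shift _ (f := num_nice i j)) //; congr (_ + _).
  (* For [i = 0] the symmetry and [num_nice_flip] reduce to a nonempty prefix, except when [j = 0],
     where the claim is the skew decomposition itself. *)
  case: i {f} => [|i]; last exact: IHn.
  rewrite (num_nice_sym 0) (@eq_conv _ _ (num_nice j 0)); last first.
    by move=> m _; apply: num_nice_sym.
  case: j => [|j]; last by rewrite num_nice_flip IHn.
  case: n {IHn} => [|n]; first by rewrite num_nice_small // /conv big_ord0.
  rewrite num_nice10 num_skewA //; apply: eq_bigr => k _; by rewrite num_nice00.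
have [m le_m] : exists m, n < m + j by exists n.+1; lia.
elim: m j le_m {f} => [|m IHm] j le_m.
  rewrite num_nice_pos_small; last by lia.
  by rewrite conv0 // => m lt_m; apply: num_nice_pos_small; lia.
rewrite num_nice_pos_rec IHm; last by lia.
rewrite [RHS](@eq_conv _ _ (fun m => num_nice_pos i.+1 j.+1 m + convA (num_nice i.+1 j) m)).
  by rewrite convD; congr (_ + _); apply: eq_conv => m' lt_m; apply: IHn.
by move=> m' _; apply: num_nice_pos_rec.
Qed.

Lemma num_doubleA n : num inA n.+2 = 2 * num_indec inA n.+2.
Proof.
(* Expanding both [num_nice 1 0] and [num_nice 1 1] gives the common part
   [num inA n.+1 + num_nice_pos 1 1 n.+2]. It equals [num_nice 1 1 n.+2], a convolution, and the
   former count has one more copy of that convolution. *)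
have eqN : num inA n.+2 = 2 * convA (num_nice 1 0) n.+2.
  have := num_niceS 0 1 n.+1; rewrite num_nice_conv (num_nice_sym 0) num_nice10 => eq11.
  rewrite -num_nice10 num_niceS num_nice_pos_rec num_nice00 -/(convA _ n.+2).
  by move: eq11; lia.
(* [num_nice 1 0] and [num inA] differ only at length 0, which isolates the last term of the skew
   decomposition. *)
have : num inA n.+2 = convA (num_nice 1 0) n.+2 + num_indec inA n.+2.
  rewrite num_skewA // /conv big_ord_recr /= [in RHS]big_ord_recr /= subnn num_nice_small //.
  rewrite muln0 addn0 -[X in _ * X]/1 muln1; congr (_ + _).
  by apply: eq_bigr => k _; case: k => k /= lt_k; rewrite subSn // num_nice10.
by rewrite eqN; lia.
Qed.

(** * Separable permutations *)

Lemma inSP w : reflect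
  ((forall a b c e, subseq [:: a; b; c; e] w -> ~~ p2413 a b c e) /\
   (forall a b c e, subseq [:: a; b; c; e] w -> ~~ p3142 a b c e)) (inS w).
Proof.
rewrite /inS /avoids_all /= andbT.
by apply: (iffP andP) => [[/av2413P ? /av3142P ?] | [? ?]];
  split=> //; [exact/av2413P | exact/av3142P].
Qed.

Lemma inS_skew k u v : all (leq k) u -> all (gtn k) v -> inS u -> inS v -> inS (u ++ v).
Proof.
move=> hu hv /inSP[u1 u2] /inSP[v1 v2]; apply/inSP.
split=> a b c e /subseq_cat_split[i [le s1 s2]].
  have := all_subseq hv s2; have := all_subseq hu s1.
  case: i le s1 s2 => [|[|[|[|[|i]]]]] //= _ s1 s2 l1 l2;
    first [exact: u1 | exact: v1 | by apply/negP; move: l1 l2; clear; rewrite /p2413; lia].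
have := all_subseq hv s2; have := all_subseq hu s1.
case: i le s1 s2 => [|[|[|[|[|i]]]]] //= _ s1 s2 l1 l2;
  first [exact: u2 | exact: v2 | by apply/negP; move: l1 l2; clear; rewrite /p3142; lia].
Qed.

Lemma num_skewS n : 0 < n ->
  num inS n = \sum_(k < n) num_indec inS k.+1 * num inS (n - k.+1).
Proof.
apply: num_skew; [exact: avoids_all_subseq | exact: avoids_all_shift | exact: inS_skew].
Qed.

Lemma compl_perms n w : w \in perms n -> compl n w \in perms n.
Proof. by move/rc_perms; rewrite !mem_permutations perm_rev. Qed.

Lemma complK n w : w \in perms n -> compl n (compl n w) = w.
Proof.
by move/perms_lt/allP=> lt_w; rewrite /compl -map_comp map_id_in // => y /lt_w /=; lia.
Qed.

Lemma subseq_compl4 n a b c e w : subseq [:: a; b; c; e] (compl n w) ->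
  exists a' b' c' e', subseq [:: a'; b'; c'; e'] w /\
    [:: a; b; c; e] = compl n [:: a'; b'; c'; e'].
Proof.
case/subseqP=> m _; rewrite /compl -map_mask => eq_t.
have := mask_subseq m w; have := congr1 size eq_t; rewrite size_map.
case: (mask m w) eq_t => [|a' [|b' [|c' [|e' []]]]] // eq_t _ sub.
by exists a', b', c', e'.
Qed.

(** Complementation exchanges 2413 and 3142. *)
Lemma inS_compl n w : w \in perms n -> inS w -> inS (compl n w).
Proof.
move=> /perms_lt lt_w /inSP[S1 S2].
apply/inSP; split=> a b c e /subseq_compl4[a' [b' [c' [e' [sub]]]]] [-> -> -> ->].
  have := S2 _ _ _ _ sub; have := all_subseq lt_w sub; rewrite /p3142 /p2413 /=; clear; lia.
have := S1 _ _ _ _ sub; have := all_subseq lt_w sub; rewrite /p3142 /p2413 /=; clear; lia.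
Qed.

Lemma filter_split (a : pred nat) v :
  (forall y z, subseq [:: y; z] v -> a y -> a z) -> v = filter (predC a) v ++ filter a v.
Proof.
elim: v => //= x v IHv up.
have {IHv} eq_v : v = filter (predC a) v ++ filter a v.
  apply: IHv => y z sub; apply: up; case: ifP => // _.
  by apply: subseq_trans sub; apply: subseq_cons.
case: (boolP (a x)) => [ax|nax] /=; last by rewrite -eq_v.
have /allP all_a : all a v.
  by apply/allP=> y y_v; apply: up ax; rewrite eqxx sub1seq.
rewrite (_ : filter a v = v); last exact/all_filterP/allP.
rewrite (_ : filter _ v = [::]) // -(filter_pred0 v).
by apply: eq_in_filter => y /all_a /= ->.
Qed.

Lemma neq_nil_mem u : u != [::] -> exists x, x \in u.
Proof. by case: u => // x u _; exists x; rewrite mem_head. Qed.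

Definition below u v := forall x y, x \in u -> y \in v -> x < y.

(** Induction on the word: split the tail as [u ++ v] and compare the first letter [x] with [v].
    Either [x] splits off alone, or [v] is cut at the value [x] and its part near [u] joins [x] and
    [u]. *)
Lemma separable_split w : uniq w -> inS w -> 1 < size w ->
  exists u v, [/\ w = u ++ v, u != [::], v != [::] & below u v \/ below v u].
Proof.
elim: w => // x [//|y [|z R]] IHw un S_w _.
  exists [:: x], [:: y]; split=> //; move: un; rewrite /= !inE andbT neq_ltn => /orP[] lt.
    by left=> ? ?; rewrite !inE => /eqP-> /eqP->.
  by right=> ? ?; rewrite !inE => /eqP-> /eqP->.
have [S1 S2] := inSP _ S_w.
have [||//|u [v [eq_R u0 v0 sep]]] := IHw; first by case/andP: un.
  by apply: avoids_all_subseq S_w; apply: subseq_cons.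
move: {IHw S_w} (y :: z :: R) un S1 S2 eq_R => {y z R} R un S1 S2 eq_R; subst R.
have [b b_u] := neq_nil_mem u0; have [c c_v] := neq_nil_mem v0.
have uv0 : u ++ v != [::] by case: (u) u0.
have x_uv t : t \in u ++ v -> t != x.
  by move=> t_uv; apply: contraTneq un => <-; rewrite /= t_uv.
have sub4 t t' : subseq [:: t; t'] v -> subseq [:: x; b; t; t'] (x :: u ++ v).
  by move=> sub; rewrite /= eqxx; apply: (@cat_subseq _ [:: b]) sub; rewrite sub1seq.
have in_v t : t \in v -> t \in u ++ v by rewrite mem_cat => ->; rewrite orbT.
have memr (t t' : nat) : subseq [:: t; t'] v -> t' \in v.
  by move/mem_subseq; apply; rewrite !inE eqxx orbT.
have neq t : t \in u ++ v -> (t < x) || (x < t) by move/x_uv; rewrite neq_ltn.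
case: sep => sep.
- case: (boolP (has (ltn x) v)) => [has_v|no_v]; last first.
    exists [:: x], (u ++ v); split=> //.
    have lt_v t : t \in v -> t < x.
      move=> t_v; have := neq t (in_v t t_v); case/orP=> // lt_xt.
      by case/hasP: no_v; exists t.
    right=> t x'; rewrite inE mem_cat => + /eqP->; case/orP=> [t_u|/lt_v//].
    exact: ltn_trans (sep _ _ t_u c_v) (lt_v c c_v).
  (* In [v] a letter above [x] followed by one below it would form 3142 with [x] and a letter [b] of
     [u]. *)
  have eq_v : v = filter (predC (ltn x)) v ++ filter (ltn x) v.
    apply: filter_split => t t' sub /= lt_t.
    case/orP: (neq t' (in_v _ (memr _ _ sub))) => // lt_t'.
    have := S2 _ _ _ _ (sub4 _ _ sub); have := sep _ _ b_u (memr _ _ sub).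
    by rewrite /p3142; move: lt_t lt_t'; clear; lia.
  exists (x :: u ++ filter (predC (ltn x)) v), (filter (ltn x) v); split=> //.
  + by rewrite /= -catA -eq_v.
  + by rewrite -has_filter.
  left=> t t'; rewrite inE mem_cat !mem_filter /= => H /andP[lt_t' t'_v].
  case/or3P: H => [/eqP->//|t_u|/andP[ge_t t_v]]; first exact: sep.
  by apply: leq_ltn_trans lt_t'; rewrite leqNgt.
case: (boolP (has (gtn x) v)) => [has_v|no_v]; last first.
  exists [:: x], (u ++ v); split=> //.
  have lt_v t : t \in v -> x < t.
    move=> t_v; have := neq t (in_v t t_v); case/orP=> // lt_xt.
    by case/hasP: no_v; exists t.
  left=> x' t; rewrite inE mem_cat => /eqP->; case/orP=> [t_u|/lt_v//].
  exact: ltn_trans (lt_v c c_v) (sep _ _ c_v t_u).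
(* The mirrored case: here [x], [b] and the two letters would form 2413. *)
have eq_v : v = filter (predC (gtn x)) v ++ filter (gtn x) v.
  apply: filter_split => t t' sub /= lt_t.
  case/orP: (neq t' (in_v _ (memr _ _ sub))) => // lt_t'.
  have := S1 _ _ _ _ (sub4 _ _ sub); have := sep _ _ (memr _ _ sub) b_u.
  by rewrite /p2413; move: lt_t lt_t'; clear; lia.
exists (x :: u ++ filter (predC (gtn x)) v), (filter (gtn x) v); split=> //.
- by rewrite /= -catA -eq_v.
- by rewrite -has_filter.
right=> t' t; rewrite inE mem_cat !mem_filter /= => /andP[lt_t' t'_v].
case/or3P=> [/eqP->//|t_u|/andP[ge_t t_v]]; first exact: sep.
by apply: leq_trans lt_t' _; rewrite leqNgt.
Qed.

Lemma below_not_indec n u v : u ++ v \in perms n -> u != [::] -> v != [::] ->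
  below v u -> ~~ indec (u ++ v).
Proof.
move=> w_n u0 v0 lt_vu; apply/negP=> /indecP/(_ (size v)).
have [_ ->] := perms_cut w_n (fun x y xu yv => lt_vu y x yv xu).
by rewrite size_cat; case: u u0 {w_n lt_vu} => // a u _; case: v v0 => // b v _ /=; lia.
Qed.

(** [separable_split] must yield a sum decomposition, which complementation turns into a skew
    one. *)
Lemma separable_indec n w : w \in perms n -> 1 < n -> inS w -> indec w -> ~~ indec (compl n w).
Proof.
move=> w_n n_gt1 S_w ind.
have [|u [v [eq_w u0 v0 [lt_uv|lt_vu]]]] := separable_split (perms_uniq w_n) S_w.
- by rewrite (perms_size w_n).
- have := compl_perms w_n; rewrite eq_w /compl map_cat => cw_n.
  apply: (below_not_indec cw_n); [by case: (u) u0 | by case: (v) v0 |].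
  move=> _ _ /mapP[y y_v ->] /mapP[x x_u ->]; have := lt_uv _ _ x_u y_v.
  have := perms_mem w_n y; rewrite eq_w mem_cat y_v orbT => /esym; rewrite inE; clear; lia.
by have := @below_not_indec n u v; rewrite -eq_w ind => /(_ w_n u0 v0 lt_vu).
Qed.

Lemma block_nth n k w i : w \in perms n -> block k 0 w -> i < n ->
  (nth 0 w i < k) = (n - k <= i).
Proof.
move=> w_n bl lt_i; have sz := perms_size w_n; have /andP[le_k _] := bl.
have /andP[h1 _] := block_highs w_n bl.
rewrite subn0 sz in h1; rewrite add0n sz in le_k.
have sz1 : size (take (n - k) w) = n - k by rewrite size_takel // sz leq_subr.
have := block_cat bl; rewrite subn0 drop_oversize // cats0 sz => {1}->.
rewrite nth_cat sz1; case: (ltnP i (n - k)) => [lt_ik|le_ki].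
  rewrite -sz1 in lt_ik; apply: negbTE; rewrite -leqNgt; exact: allP h1 _ (mem_nth 0 lt_ik).
have lt_i' : i - (n - k) < size (lows k w).
  by rewrite (perms_size (lows_perms w_n le_k)); move: lt_i le_ki le_k; clear; lia.
by have := mem_nth 0 lt_i'; rewrite mem_filter => /andP[].
Qed.

(** A skew cut forces the first letter to exceed the last; this cannot hold for both a word and its
    complement. *)
Lemma not_indec_compl n w : w \in perms n -> ~~ indec w -> indec (compl n w).
Proof.
move=> w_n; rewrite -has_predC => /hasP[k].
rewrite mem_iota (perms_size w_n) => le_k /= /negPn bl.
have cw_n := compl_perms w_n; apply/indecP=> k'; rewrite (perms_size cw_n) => le_k'.
apply/negP=> bl'.
have lt0 : 0 < n by move: le_k'; clear; lia.
have ltn1 : n.-1 < n by rewrite prednK.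
have := block_nth w_n bl lt0; have := block_nth w_n bl ltn1.
have := block_nth cw_n bl' lt0; have := block_nth cw_n bl' ltn1.
have sz := perms_size w_n; have lt_w i : i < n -> nth 0 w i < n.
  move=> lt_i; have := perms_mem w_n (nth 0 w i).
  by rewrite mem_nth ?sz // => /esym; rewrite inE.
rewrite /compl !(nth_map 0) ?sz //; have := lt_w _ lt0; have := lt_w _ ltn1.
by move: le_k le_k'; clear; lia.
Qed.

(** Complementation matches the skew-indecomposable words of the class with the decomposable
    ones. *)
Lemma num_doubleS n : num inS n.+2 = 2 * num_indec inS n.+2.
Proof.
rewrite /num (count_split _ indec) mul2n -addnn; congr (_ + _).
apply: (@count_bij _ _ _ _ _ _ (compl n.+2) (compl n.+2)); rewrite ?permutations_uniq //.
  move=> w w_n /andP[S_w ind]; rewrite compl_perms ?complK //; split=> //.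
  by rewrite inS_compl //= not_indec_compl.
move=> w w_n /andP[S_w ind]; rewrite compl_perms ?complK //; split=> //.
by rewrite inS_compl //= separable_indec.
Qed.

(** Joint strong induction. In length at least 2, doubling turns the skew decomposition into a
    formula for [num_indec] whose terms are already known to agree. *)
Lemma num_eq n : num inA n = num inS n /\ num_indec inA n.+1 = num_indec inS n.+1.
Proof.
elim/ltn_ind: n => n IHn.
have eq_h k : k < n -> num_indec inA k.+1 = num_indec inS k.+1 by case/IHn.
have eq_a : forall m, m <= n -> num inA m = num inS m.
  move=> m; rewrite leq_eqVlt => /orP[/eqP->|/IHn[]//].
  case: n IHn eq_h => // n IHn eq_h; rewrite num_skewA // num_skewS //; apply: eq_bigr => k _.
  by rewrite eq_h //; have [|-> _] := IHn (n.+1 - k.+1); first by lia.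
split; first exact: eq_a.
case: n {IHn} eq_h eq_a => // n eq_h eq_a.
have eqS : num inS n.+2 = num_indec inS n.+2 +
    \sum_(k < n.+1) num_indec inS k.+1 * num inS (n.+2 - k.+1).
  by rewrite num_skewS // big_ord_recr /= subnn -[num inS 0]/1 muln1 addnC.
have eqA : num inA n.+2 = num_indec inA n.+2 +
    \sum_(k < n.+1) num_indec inS k.+1 * num inS (n.+2 - k.+1).
  rewrite num_skewA // big_ord_recr /= subnn -[num inA 0]/1 muln1 addnC; congr (_ + _).
  by apply: eq_bigr => k _; rewrite eq_h ?eq_a //; case: k => k /=; lia.
by have := num_doubleA n; have := num_doubleS n; move: eqS eqA; lia.
Qed.

Theorem theorem2p2 :
  wilf_equivalent
    [:: [:: 2; 1; 4; 3]; [:: 3; 1; 4; 2]; [:: 2; 4; 6; 1; 3; 5]]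
    [:: [:: 2; 4; 1; 3]; [:: 3; 1; 4; 2]].
Proof. by move=> n; rewrite !card_Av; case: (num_eq n). Qed.
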